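(* Under the left-absorbing, non-commutative provenance semantics described in the context, the following problem is decidable in polynomial time: given a finite annotated $\mathcal{ELH}^r$ TBox $\mathcal{T}$, two concept names $A_0,B_0$, and a monomial $m$, decide whether $\mathcal{T}\models(A_0\sqsubseteq B_0, m)$.
   Context: Fix pairwise disjoint countable sets $N_C$ (concept names), $N_R$ (role names) and $N_V$ (provenance variables). A monomial is a finite product $x_1\times\cdots\times x_k$ of variables from $N_V$ (the empty product is $1$); $N_M$ is the set of all monomials. Here the product $\times$ is associative but non-commutative and left-absorbing: among multiple occurrences of the same variable only the first (left-most) one counts, so e.g. $u\times v\times u = u\times v \neq v\times u$. Restricted $\mathcal{ELH}^r$ axioms: general concept inclusions $C \sqsubseteq D$ where $C ::= A \mid \exists R.C \mid C \sqcap C \mid \top$ and $D ::= A \mid \exists R$ ($A\in N_C$, $R\in N_R$); role inclusions $R \sqsubseteq S$; range restrictions $\mathsf{ran}(R) \sqsubseteq A$. An annotated TBox is a finite set of pairs $(\alpha, v)$ with $\alpha$ such an axiom and $v \in N_V \cup \{1\}$. An annotated interpretation is $\mathcal{I}=(\Delta^\mathcal{I},\Delta^\mathcal{I}_{\mathsf m},\cdot^\mathcal{I})$ with $\Delta^\mathcal{I},\Delta^\mathcal{I}_{\mathsf m}$ nonempty disjoint sets, $A^\mathcal{I}\subseteq \Delta^\mathcal{I}\times\Delta^\mathcal{I}_{\mathsf m}$, $R^\mathcal{I}\subseteq\Delta^\mathcal{I}\times\Delta^\mathcal{I}\times\Delta^\mathcal{I}_{\mathsf m}$, and $\mu^\mathcal{I}\in\Delta^\mathcal{I}_{\mathsf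 m}$ for each $\mu\in N_M$, with $\mu^\mathcal{I}=\nu^\mathcal{I}$ iff $\mu,\nu$ are equal modulo associativity and left-absorption. It is extended by: $\top^\mathcal{I}=\Delta^\mathcal{I}\times\{1^\mathcal{I}\}$; $(\exists R)^\mathcal{I}=\{(d,\mu^\mathcal{I})\mid \exists e\,(d,e,\mu^\mathcal{I})\in R^\mathcal{I}\}$; $(C\sqcap D)^\mathcal{I}=\{(d,(\mu\times\nu)^\mathcal{I})\mid (d,\mu^\mathcal{I})\in C^\mathcal{I},(d,\nu^\mathcal{I})\in D^\mathcal{I}\}$; $(\mathsf{ran}(R))^\mathcal{I}=\{(e,\mu^\mathcal{I})\mid\exists d\,(d,e,\mu^\mathcal{I})\in R^\mathcal{I}\}$; $(\exists R.C)^\mathcal{I}=\{(d,(\mu\times\nu)^\mathcal{I})\mid \exists e\,(d,e,\mu^\mathcal{I})\in R^\mathcal{I},(e,\nu^\mathcal{I})\in C^\mathcal{I}\}$. $\mathcal{I}$ satisfies $(R\sqsubseteq S,\mu)$ if for all $\nu\in N_M$, $(d,e,\nu^\mathcal{I})\in R^\mathcal{I}$ implies $(d,e,(\mu\times\nu)^\mathcal{I})\in S^\mathcal{I}$; it satisfies $(C\sqsubseteq D,\mu)$ (including $C=\mathsf{ran}(R)$) if for all $\nu\in N_M$, $(d,\nu^\mathcal{I})\in C^\mathcal{I}$ implies $(d,(\mu\times\nu)^\mathcal{I})\in D^\mathcal{I}$. $\mathcal{I}$ is a model of $\mathcal{T}$ if it satisfies all annotated axioms of $\mathcal{T}$; $\mathcal{T}\models(\alpha,\mu)$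 if every model of $\mathcal{T}$ satisfies $(\alpha,\mu)$. Polynomial time is measured in the sizes of $\mathcal{T}$ and $m$. *)

(* Defs.v *)
From HB Require Import structures.
From mathcomp Require Import all_boot.
From Stdlib Require List.

Set Implicit Arguments.
Unset Strict Implicit.
Unset Printing Implicit Defensive.

(* Names are bit strings, so that a name is its own spelling on a tape.  The
   three countably infinite sets of names are kept apart by the syntax: no
   position of an axiom accepts names of two sorts. *)
Definition cname := seq bool.
Definition rname := seq bool.
Definition pvar := seq bool.

(* The product is concatenation and the empty product 1 is [::]. *)
Definition monomial := seq pvar.

(* [undup] keeps the last occurrence of each item, hence the reversals: only
   the left-most occurrence of a variable survives. *)
Definition leftmost (m : monomial) : monomial := rev (undup (rev m)).

Definition eq_absorb (m n : monomial) : Prop := leftmost m = leftmost n.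

Inductive concept :=
| CTop
| CName of cname
| CEx of rname & concept
| CAnd of concept & concept.

Inductive rhs :=
| RName of cname
| REx of rname.

Inductive axiom :=
| GCI of concept & rhs
| RoleIncl of rname & rname
| RanRestr of rname & cname.

Definition annotation := option pvar.

Definition mon_of_annotation (a : annotation) : monomial :=
  if a is Some v then [:: v] else [::].

(* A finite set is given by a list of its elements. *)
Definition tbox := seq (axiom * annotation).

(* The two domains are types, hence disjoint; [mdom] is inhabited by the
   interpretation of 1.  [mdom] may contain more than the interpretations of
   monomials. *)
Record interp := Interp {
  dom : Type;
  mdom : Type;
  dom_inh : inhabited dom;
  conc : cname -> dom -> mdom -> Prop;
  role : rname -> dom -> dom -> mdom -> Prop;
  mon : monomial -> mdom;
  monP : forall m n : monomial, mon m = mon n <-> eq_absorb m n }.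

Section Extension.
Variable I : interp.

Fixpoint cext (C : concept) (d : dom I) (a : mdom I) : Prop :=
  match C with
  | CTop => a = mon I [::]
  | CName A => conc A d a
  | CEx R C' => exists (e : dom I) (m n : monomial),
      [/\ role R d e (mon I m), cext C' e (mon I n) & a = mon I (m ++ n)]
  | CAnd C1 C2 => exists m n : monomial,
      [/\ cext C1 d (mon I m), cext C2 d (mon I n) & a = mon I (m ++ n)]
  end.

Definition rhs_ext (D : rhs) (d : dom I) (a : mdom I) : Prop :=
  match D with
  | RName A => conc A d a
  | REx R => exists (e : dom I) (m : monomial),
      role R d e (mon I m) /\ a = mon I m
  end.

Definition ran_ext (R : rname) (e : dom I) (a : mdom I) : Prop :=
  exists (d : dom I) (m : monomial), role R d e (mon I m) /\ a = mon I m.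

Definition satisfies (ax : axiom) (m : monomial) : Prop :=
  match ax with
  | GCI C D => forall (n : monomial) (d : dom I),
      cext C d (mon I n) -> rhs_ext D d (mon I (m ++ n))
  | RoleIncl R1 R2 => forall (n : monomial) (d e : dom I),
      role R1 d e (mon I n) -> role R2 d e (mon I (m ++ n))
  | RanRestr R A => forall (n : monomial) (d : dom I),
      ran_ext R d (mon I n) -> conc A d (mon I (m ++ n))
  end.

Definition is_model (T : tbox) : Prop :=
  forall (ax : axiom) (a : annotation),
    List.In (ax, a) T -> satisfies ax (mon_of_annotation a).

End Extension.

Definition entails (T : tbox) (ax : axiom) (m : monomial) : Prop :=
  forall I : interp, is_model I T -> satisfies I ax m.

Inductive move := MLeft | MStay | MRight.

(* A two-way infinite tape seen from its head: [None] is the blank, the cell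
   nearest to the head comes first in both lists, and all the cells beyond the
   lists are blank. *)
Record tape (G : Type) := Tape {
  tleft : seq (option G);
  tcur : option G;
  tright : seq (option G) }.

Definition tape_write (G : Type) (a : option G) (t : tape G) : tape G :=
  Tape (tleft t) a (tright t).

Definition tape_move (G : Type) (mv : move) (t : tape G) : tape G :=
  match mv with
  | MLeft => Tape (behead (tleft t)) (head None (tleft t)) (tcur t :: tright t)
  | MStay => t
  | MRight => Tape (tcur t :: tleft t) (head None (tright t)) (behead (tright t))
  end.

(* The answer of a halting state [q] is the [b] such that
   [tm_halt q = Some b]. *)
Record tm (A : finType) := TM {
  tm_aux : finType;
  tm_work : nat;
  tm_state : finType;
  tm_start : tm_state;
  tm_halt : tm_state -> option bool;
  tm_step : tm_state -> {ffun 'I_tm_work.+1 -> option (A + tm_aux)} ->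
    tm_state * {ffun 'I_tm_work.+1 -> option (A + tm_aux) * move} }.

Section Run.
Variables (A : finType) (M : tm A).

Definition tm_sym : Type := (A + tm_aux M)%type.

Definition tm_tapes : Type := {ffun 'I_(tm_work M).+1 -> tape tm_sym}.

Definition tm_config : Type := (tm_state M * tm_tapes)%type.

Definition input_tape (w : seq A) : tape tm_sym :=
  let cells : seq (option tm_sym) := [seq Some (inl a) | a <- w] in
  Tape [::] (head None cells) (behead cells).

Definition tm_init (w : seq A) : tm_config :=
  (tm_start M,
   [ffun i => if i == ord0 then input_tape w else Tape [::] None [::]]).

Definition tm_next (c : tm_config) : tm_config :=
  let: (q, ts) := c in
  if tm_halt q is Some _ then c else
  let: (q', act) := tm_step q [ffun i => tcur (ts i)] in
  (q', [ffun i => tape_move (act i).2 (tape_write (act i).1 (ts i))]).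

Definition answers_within (w : seq A) (t : nat) (b : bool) : Prop :=
  tm_halt (iter t tm_next (tm_init w)).1 = Some b.

End Run.

Definition decidable_in_ptime (A : finType) (X : Type) (enc : X -> seq A)
    (P : X -> Prop) : Prop :=
  exists (M : tm A) (c k : nat), forall x : X, exists b : bool,
    answers_within M (enc x) (c * size (enc x) ^ k + c) b /\ (b = true <-> P x).

Inductive symbol :=
| SBit of bool | SEnd
| STop | SName | SEx | SAnd
| SGCI | SRole | SRan
| SOne | SVar | SSep.

Definition symbol_enum : seq symbol :=
  [:: SBit false; SBit true; SEnd; STop; SName; SEx; SAnd; SGCI; SRole; SRan;
      SOne; SVar; SSep].

Definition symbol_code (s : symbol) : nat :=
  match s with
  | SBit b => b
  | SEnd => 2 | STop => 3 | SName => 4 | SEx => 5 | SAnd => 6 | SGCI => 7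
  | SRole => 8 | SRan => 9 | SOne => 10 | SVar => 11 | SSep => 12
  end.

Lemma symbol_codeK : cancel symbol_code (nth SEnd symbol_enum).
Proof. by case=> // -[]. Qed.

HB.instance Definition _ := Countable.copy symbol (can_type symbol_codeK).

Lemma symbol_enumP : Finite.axiom symbol_enum.
Proof. by case=> // -[]. Qed.

HB.instance Definition _ := isFinite.Build symbol symbol_enumP.

Definition enc_name (s : seq bool) : seq symbol := rcons (map SBit s) SEnd.

Fixpoint enc_concept (C : concept) : seq symbol :=
  match C with
  | CTop => [:: STop]
  | CName A => SName :: enc_name A
  | CEx R C' => SEx :: enc_name R ++ enc_concept C'
  | CAnd C1 C2 => SAnd :: enc_concept C1 ++ enc_concept C2
  end.

Definition enc_rhs (D : rhs) : seq symbol :=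
  match D with
  | RName A => SName :: enc_name A
  | REx R => SEx :: enc_name R
  end.

Definition enc_axiom (ax : axiom) : seq symbol :=
  match ax with
  | GCI C D => SGCI :: enc_concept C ++ enc_rhs D
  | RoleIncl R1 R2 => SRole :: enc_name R1 ++ enc_name R2
  | RanRestr R A => SRan :: enc_name R ++ enc_name A
  end.

Definition enc_annotation (a : annotation) : seq symbol :=
  if a is Some v then SVar :: enc_name v else [:: SOne].

Definition enc_tbox (T : tbox) : seq symbol :=
  flatten [seq enc_axiom p.1 ++ enc_annotation p.2 | p <- T].

Definition enc_monomial (m : monomial) : seq symbol :=
  flatten [seq SVar :: enc_name v | v <- m].

Record instance := Instance {
  inst_tbox : tbox;
  inst_lhs : cname;
  inst_rhs : cname;
  inst_mon : monomial }.

Definition enc_instance (x : instance) : seq symbol :=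
  enc_name (inst_lhs x) ++ enc_name (inst_rhs x) ++
  enc_monomial (inst_mon x) ++ SSep :: enc_tbox (inst_tbox x).

Lemma enc_name_inj s s' u u' :
  enc_name s ++ u = enc_name s' ++ u' -> s = s' /\ u = u'.
Proof.
elim: s s' => [|b s IHs] [|b' s'] //= => [[->] //|[<-]] /IHs[-> ->] //.
Qed.

Lemma enc_concept_inj C C' u u' :
  enc_concept C ++ u = enc_concept C' ++ u' -> C = C' /\ u = u'.
Proof.
elim: C C' u u' => [|A|R C IH|C1 IH1 C2 IH2] [|A'|R' C'|C1' C2'] u u' //=.
- by case.
- by case=> /enc_name_inj[-> ->].
- by case; rewrite -!catA => /enc_name_inj[->] /IH[-> ->].
- by case; rewrite -!catA => /IH1[->] /IH2[-> ->].
Qed.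

Lemma enc_axiom_inj a a' u u' :
  enc_axiom a ++ u = enc_axiom a' ++ u' -> a = a' /\ u = u'.
Proof.
case: a a' => [C D|R1 R2|R A] [C' D'|R1' R2'|R' A'] //= []; rewrite -!catA.
- move=> /enc_concept_inj[->].
  by case: D D' => [B|R] [B'|R'] //= [] /enc_name_inj[-> ->].
- by move=> /enc_name_inj[->] /enc_name_inj[-> ->].
- by move=> /enc_name_inj[->] /enc_name_inj[-> ->].
Qed.

Lemma enc_tbox_inj : injective enc_tbox.
Proof.
rewrite /enc_tbox; elim=> [|[a v] T IH] [|[a' v'] T'] //=.
- by case: a'.
- by case: a.
rewrite -!catA => /enc_axiom_inj[->].
case: v v' => [v|] [v'|] //= [].
- by move=> /enc_name_inj[->] /IH->.
- by move=> /IH->.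
Qed.

Lemma enc_instance_inj : injective enc_instance.
Proof.
case=> [T A B m] [T' A' B' m']; rewrite /enc_instance /=.
move=> /enc_name_inj[->] /enc_name_inj[->]; rewrite /enc_monomial.
elim: m m' => [|v m IH] [|v' m'] //= []; first by move=> /enc_tbox_inj->.
by rewrite -!catA => /enc_name_inj[->] /IH[-> ->].
Qed.

(* Main.v *)
(** Since an annotation absorbs on the left, entailment can be tested on the
    single assertion A0(a) annotated with a fresh variable x: one asks whether
    B0(a) is derivable with annotation M = m x.  Whatever is derived on the way
    matters only through its action on the prefixes of M: a word u takes the
    prefix i to the prefix j when M_i u = M_j, and this action is compatible
    with the product.  Hence it is enough to know, for every node c and concept
    C, the polynomially many pairs (i, j) such that C holds at c with some
    annotation taking i to j.  The nodes are the root and one generic successor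
    for each right-hand side [exists R]: the annotation w of the edge leading to
    a successor is a factor of all that is derived there, but it is absorbed,
    because a concept [exists S.C] multiplies w on the left of what it takes
    from the successor.  So the successor may be explored as if w were 1,
    starting from a prefix that already contains the letters of w.

    These facts are the least model of a fixed Datalog program whose constants
    are the positions of the input: a subconcept, a name or a prefix of M is
    represented by the place where it starts (position 0 standing for the root
    and for M itself), and parsing is done by the program as well.  A Datalog
    program is evaluated in polynomial time by a Turing machine having one head
    on a copy of the input for each variable, and a table of facts that is
    reached by nested loops.

    Completeness uses the canonical model, whose elements are sequences of
    edges labelled with a role and an annotation. *)
From HB Require Import structures.
From mathcomp Require Import all_boot zify.
From Stdlib Require Import FunctionalExtensionality.
From Stdlib Require List.
Require Import Defs.

Set Implicit Arguments.
Unset Strict Implicit.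
Unset Printing Implicit Defensive.

(** * Programs on multi-tape machines *)

Definition upd (V : Type) (f : nat -> V) (i : nat) (v : V) : nat -> V :=
  fun j => if j == i then v else f j.

Lemma upd_same V (f : nat -> V) i v : upd f i v i = v.
Proof. by rewrite /upd eqxx. Qed.

Lemma upd_other V (f : nat -> V) i v j : j != i -> upd f i v j = f j.
Proof. by rewrite /upd => /negbTE->. Qed.

Lemma upd_upd V (f : nat -> V) i u v : upd (upd f i u) i v = upd f i v.
Proof. by apply: functional_extensionality => j; rewrite /upd; case: eqP. Qed.

Lemma upd_id V (f : nat -> V) i v : f i = v -> upd f i v = f.
Proof.
by move=> fi; apply: functional_extensionality => j; rewrite /upd; case: eqP => [->|].
Qed.

Section WhilePrograms.
Variables (A aux : finType) (K : nat).

Definition cell : Type := option (A + aux).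

(* [Op i j f mv b] rewrites the scanned cell of tape [j] and moves its head,
   looking also at tape [i], and returns the value of [b] on the latter. *)
Inductive cmd :=
| Op of nat & nat & (cell -> cell -> cell) & move & (cell -> bool)
| Ite of cmd & cmd & cmd
| Wh of cmd & cmd.

Record state := MkState { ptr : nat -> nat; cel : nat -> nat -> cell }.

Definition scan (s : state) (i : nat) : cell := cel s i (ptr s i).

Definition shift (mv : move) (p : nat) : nat :=
  match mv with MLeft => p.-1 | MStay => p | MRight => p.+1 end.

Definition op_state j a mv (s : state) : state :=
  MkState (upd (ptr s) j (shift mv (ptr s j)))
        (upd (cel s) j (upd (cel s j) (ptr s j) a)).

(** The last argument counts machine steps exactly: [stp] passes control to the next command in the
    very step that ends the previous one. The premise on [MLeft] keeps the heads on the positions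
    that [represents] describes. *)
Inductive exec : cmd -> state -> bool -> state -> nat -> Prop :=
| ExecOp i j f mv b s : i <= K -> j <= K -> (mv = MLeft -> 0 < ptr s j) ->
    exec (Op i j f mv b) s (b (scan s i))
      (op_state j (f (scan s i) (scan s j)) mv s) 1
| ExecIte c c1 c2 s b s' t b' s'' t' : exec c s b s' t ->
    exec (if b then c1 else c2) s' b' s'' t' ->
    exec (Ite c c1 c2) s b' s'' (t + t')
| ExecWhF c c1 s s' t : exec c s false s' t -> exec (Wh c c1) s true s' t
| ExecWhT c c1 s s1 t1 b s2 t2 s3 t3 : exec c s true s1 t1 ->
    exec c1 s1 b s2 t2 -> exec (Wh c c1) s2 true s3 t3 ->
    exec (Wh c c1) s true s3 (t1 + (t2 + t3)).

Definition reads : Type := {ffun 'I_K.+1 -> cell}.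
Definition acts : Type := {ffun 'I_K.+1 -> cell * move}.
Definition tapes : Type := {ffun 'I_K.+1 -> tape (A + aux)}.

Fixpoint ctl (c : cmd) : finType :=
  match c with
  | Op _ _ _ _ _ => unit
  | Ite c c1 c2 => (ctl c + (ctl c1 + ctl c2))%type
  | Wh c c1 => (ctl c + ctl c1)%type
  end.

Fixpoint entry (c : cmd) : ctl c :=
  match c return ctl c with
  | Op _ _ _ _ _ => tt
  | Ite c c1 c2 => inl (entry c)
  | Wh c c1 => inl (entry c)
  end.

Definition op_acts (i j : nat) (f : cell -> cell -> cell) (mv : move)
    (r : reads) : acts :=
  [ffun k : 'I_K.+1 =>
     if k == j :> nat then (f (r (inord i)) (r k), mv) else (r k, MStay)].

(** The result [inr b] is the exit with value [b]; the enclosing command turns it into the entry of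
    the next one. *)
Fixpoint stp (c : cmd) : ctl c -> reads -> (ctl c + bool) * acts :=
  match c return ctl c -> reads -> (ctl c + bool) * acts with
  | Op i j f mv b => fun _ r => (inr (b (r (inord i))), op_acts i j f mv r)
  | Ite c c1 c2 => fun q r =>
      match q with
      | inl q => let: (o, a) := stp q r in
          (match o with
           | inl q' => inl (inl q')
           | inr b => inl (inr (if b then inl (entry c1) else inr (entry c2)))
           end, a)
      | inr (inl q) => let: (o, a) := stp q r in
          (match o with inl q' => inl (inr (inl q')) | inr b => inr b end, a)
      | inr (inr q) => let: (o, a) := stp q r in
          (match o with inl q' => inl (inr (inr q')) | inr b => inr b end, a)
      end
  | Wh c c1 => fun q r =>
      match q with
      | inl q => let: (o, a) := stp q r in
          (match o with
           | inl q' => inl (inl q')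
           | inr b => if b then inl (inr (entry c1)) else inr true
           end, a)
      | inr q => let: (o, a) := stp q r in
          (match o with
           | inl q' => inl (inr q')
           | inr b => inl (inl (entry c))
           end, a)
      end
  end.

Definition scans (ts : tapes) : reads := [ffun i => tcur (ts i)].
Definition perform (a : acts) (ts : tapes) : tapes :=
  [ffun i => tape_move (a i).2 (tape_write (a i).1 (ts i))].

Inductive reach (c : cmd) : ctl c -> tapes -> nat -> bool -> tapes -> Prop :=
| ReachExit q ts b a : stp q (scans ts) = (inr b, a) ->
    reach q ts 1 b (perform a ts)
| ReachStep q ts q' a n b ts' : stp q (scans ts) = (inl q', a) ->
    reach q' (perform a ts) n b ts' -> reach q ts n.+1 b ts'.

Lemma reach_ite_then c c1 c2 (q : ctl c1) ts n b ts' : reach q ts n b ts' ->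
  @reach (Ite c c1 c2) (inr (inl q)) ts n b ts'.
Proof.
elim=> {q ts n b ts'} [q ts b a e|q ts q' a n b ts' e _ IH].
  by apply: ReachExit; rewrite /= e.
by apply: ReachStep IH; rewrite /= e.
Qed.

Lemma reach_ite_else c c1 c2 (q : ctl c2) ts n b ts' : reach q ts n b ts' ->
  @reach (Ite c c1 c2) (inr (inr q)) ts n b ts'.
Proof.
elim=> {q ts n b ts'} [q ts b a e|q ts q' a n b ts' e _ IH].
  by apply: ReachExit; rewrite /= e.
by apply: ReachStep IH; rewrite /= e.
Qed.

Lemma reach_ite c c1 c2 (q : ctl c) ts n b ts' n' b' ts'' :
    reach q ts n b ts' ->
    reach (entry (if b then c1 else c2)) ts' n' b' ts'' ->
  @reach (Ite c c1 c2) (inl q) ts (n + n') b' ts''.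
Proof.
elim=> {q ts n b ts'} [q ts b a e H|q ts q' a n b ts' e _ IH H].
  rewrite add1n; apply: (@ReachStep (Ite c c1 c2) _ _
    (inr (if b then inl (entry c1) else inr (entry c2))) a).
    by rewrite /= e.
  by case: b H {e} => H; [apply: reach_ite_then|apply: reach_ite_else].
by rewrite addSn; apply: (@ReachStep (Ite c c1 c2) _ _ (inl q') a); [rewrite /= e|apply: IH].
Qed.

Lemma reach_wh_body c c1 (q : ctl c1) ts n b ts' n' b' ts'' :
    reach q ts n b ts' ->
    @reach (Wh c c1) (inl (entry c)) ts' n' b' ts'' ->
  @reach (Wh c c1) (inr q) ts (n + n') b' ts''.
Proof.
elim=> {q ts n b ts'} [q ts b a e H|q ts q' a n b ts' e _ IH H].
  by rewrite add1n; apply: (@ReachStep (Wh c c1) _ _ (inl (entry c)) a); rewrite /= ?e.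
by rewrite addSn; apply: (@ReachStep (Wh c c1) _ _ (inr q') a); [rewrite /= e|apply: IH].
Qed.

Lemma reach_wh_true c c1 (q : ctl c) ts n b ts' n' b' ts'' :
    reach q ts n b ts' -> b ->
    @reach (Wh c c1) (inr (entry c1)) ts' n' b' ts'' ->
  @reach (Wh c c1) (inl q) ts (n + n') b' ts''.
Proof.
elim=> {q ts n b ts'} [q ts b a e hb H|q ts q' a n b ts' e _ IH hb H].
  by rewrite add1n; apply: (@ReachStep (Wh c c1) _ _ (inr (entry c1)) a); rewrite /= ?e ?hb.
by rewrite addSn; apply: (@ReachStep (Wh c c1) _ _ (inl q') a); [rewrite /= e|apply: IH].
Qed.

Lemma reach_wh_false c c1 (q : ctl c) ts n b ts' :
  reach q ts n b ts' -> ~~ b -> @reach (Wh c c1) (inl q) ts n true ts'.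
Proof.
elim=> {q ts n b ts'} [q ts b a e hb|q ts q' a n b ts' e _ IH hb].
  by apply: ReachExit; rewrite /= e (negbTE hb).
by apply: (@ReachStep (Wh c c1) _ _ (inl q') a); [rewrite /= e|apply: IH].
Qed.

(* Nothing is said of the cells to the left of position 0, which no program
   visits. *)
Definition represents (t : tape (A + aux)) (f : nat -> cell) (p : nat) : Prop :=
  [/\ tcur t = f p, forall k, nth None (tright t) k = f (p + k.+1)
    & forall k, k < p -> nth None (tleft t) k = f (p - k.+1)].

Lemma represents_op t f p a mv : represents t f p -> (mv = MLeft -> 0 < p) ->
  represents (tape_move mv (tape_write a t)) (upd f p a) (shift mv p).
Proof.
case: t => l c r [/= _ hr hl] hp.
have updN k : k != p -> upd f p a k = f k by apply: upd_other.
case: mv hp => hp; split=> //=.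
- by have h0 := hp erefl; rewrite -nth0 hl ?updN; try congr f; lia.
- have h0 := hp erefl; case=> [|k] /=; first by rewrite addn1 (prednK (hp erefl)) upd_same.
  by rewrite hr updN; try congr f; lia.
- by move=> k hk; rewrite nth_behead hl ?updN; try congr f; lia.
- by rewrite upd_same.
- by move=> k; rewrite hr updN //; lia.
- by move=> k hk; rewrite hl // updN //; lia.
- by rewrite -nth0 hr updN; try congr f; lia.
- by move=> k; rewrite nth_behead hr updN; try congr f; lia.
- case=> [|k] hk /=; first by rewrite subSS subn0 upd_same.
  by rewrite hl ?updN; try congr f; lia.
Qed.

Definition models (s : state) (ts : tapes) : Prop :=
  forall i : 'I_K.+1, represents (ts i) (cel s i) (ptr s i).

(** Each constructor of [exec] corresponds to one way of gluing runs of the control automaton. *)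
Lemma exec_reach c s b s' t : exec c s b s' t -> forall ts, models s ts ->
  exists2 ts', reach (entry c) ts t b ts' & models s' ts'.
Proof.
elim=> {c s b s' t}.
- move=> i j f mv b s hi hj hmv ts hs.
  have rdE k : k <= K -> tcur (ts (inord k)) = scan s k.
    by move=> hk; have [-> _ _] := hs (inord k); rewrite /scan inordK.
  exists (perform (op_acts i j f mv (scans ts)) ts).
    by rewrite -(rdE i) // -[tcur _](ffunE (fun i => tcur (ts i))); apply: ReachExit.
  move=> k; rewrite !ffunE; have hk := hs k.
  rewrite /op_state /=; case: (eqVneq (k : nat) j) => [kj|kj].
    rewrite -kj !upd_same /= rdE // (_ : tcur (ts k) = scan s k); last by case: hk.
    by apply: represents_op; rewrite // kj.
  by rewrite !upd_other //=; move: hk; case: (ts k).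
- move=> c c1 c2 s b s' t b' s'' t' _ IH _ IH' ts /IH[ts' r1 /IH'[ts'' r2 h]].
  by exists ts''; first exact: reach_ite r1 r2.
- move=> c c1 s s' t _ IH ts /IH[ts' r h]; exists ts' => //.
  exact: reach_wh_false r isT.
- move=> c c1 s s1 t1 b s2 t2 s3 t3 _ IH1 _ IH2 _ IH3 ts.
  move=> /IH1[ts1 r1 /IH2[ts2 r2 /IH3[ts3 r3 h]]]; exists ts3 => //.
  by apply: reach_wh_true r1 isT _; apply: reach_wh_body r2 r3.
Qed.

Definition machine (c : cmd) : tm A :=
  @TM A aux K (ctl c + bool)%type (inl (entry c))
    (fun q => if q is inr b then Some b else None)
    (fun q r => if q is inl q' then stp q' r else (q, [ffun i => (r i, MStay)])).

Lemma reach_iter c (q : ctl c) ts n b ts' : reach q ts n b ts' ->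
  iter n (@tm_next A (machine c)) (inl q, ts) = (inr b, ts').
Proof.
elim=> {q ts n b ts'} [q ts b a e|q ts q' a n b ts' e _ IH].
  by rewrite /= -/(scans ts) e.
by rewrite iterSr -IH /= -/(scans ts) e.
Qed.

(** The head of the input tape starts on position 1: cell 0 is blank and will receive the left end
    mark, so that letters are numbered from 1. *)
Definition initial (w : seq A) : state :=
  MkState (fun i => (i == 0)) 
    (fun i k => if i == 0 then nth None (None :: map (Some \o inl) w) k else None).

Lemma exec_answers c w b s' t T : exec c (initial w) b s' t -> t <= T ->
  answers_within (machine c) w T b.
Proof.
move=> he hT.
have hm : models (initial w) (tm_init (machine c) w).2.
  move=> i; rewrite ffunE /initial /=; case: (eqVneq i ord0) => [->|hi] /=.
    split=> /=; first by case: w {he}.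
      by move=> k; rewrite nth_behead.
    by case.
  have -> : (i == 0 :> nat) = false by apply/negbTE; rewrite -(inj_eq val_inj) in hi.
  by split=> // k; rewrite nth_nil.
have [ts' r _] := exec_reach he hm.
rewrite /answers_within -(subnK hT) iterD (reach_iter r).
(* A halting configuration is fixed by [tm_next], so the answer persists until time [T]. *)
by elim: (T - t) => //= n; case: (iter _ _ _) => q ts /= hq; rewrite hq.
Qed.

End WhilePrograms.

(** * Datalog over the positions of a word *)

Ltac updval :=
  rewrite /= /upd; do ![case: eqP] => *; subst; try congruence; lia.

Ltac updeq :=
  apply: functional_extensionality => ?; rewrite /= /upd;
  do ![case: eqP] => *; subst; try congruence; lia.

Definition term : Type := (nat * bool)%type.
Definition term_val (rho : nat -> nat) (u : term) : nat :=
  if u.2 then (rho u.1).+1 else rho u.1.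

Section Datalog.
Variables (A pred : finType).

(** The letter [None] singles out position 0, the only value of a variable that carries no
    letter. *)
Definition guard : Type := (nat * option A)%type.
Definition atom : Type := (pred * seq term)%type.
Definition rule : Type := (seq guard * seq atom * atom)%type.

(* Letters are numbered from 1, and position 0 has none. *)
Definition letter (w : seq A) (p : nat) : option A :=
  nth None (None :: map Some w) p.

Definition atom_args (rho : nat -> nat) (a : atom) : seq nat :=
  map (term_val rho) a.2.

Inductive derives (rules : seq rule) (w : seq A) : pred -> seq nat -> Prop :=
| DerivesRule (rl : rule) (rho : nat -> nat) : rl \in rules ->
    (forall x, rho x <= size w) ->
    (forall g, g \in rl.1.1 -> letter w (rho g.1) = g.2) ->
    (forall a, a \in rl.1.2 -> derives rules w a.1 (atom_args rho a)) ->
    derives rules w rl.2.1 (atom_args rho rl.2).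

Variables (q r : nat) (rules : seq rule).

Definition atom_wf (a : atom) : bool :=
  (size a.2 == r) && all (fun u : term => u.1 < q) a.2.
Definition rule_wf (rl : rule) : bool :=
  [&& all (fun g : guard => g.1 < q) rl.1.1, all atom_wf rl.1.2 & atom_wf rl.2].

(** Facts are addressed by reading their arguments as digits in base [N]. The base will be
    [(size w).+2], because a successor term may take the value [size w + 1]. *)
Fixpoint index (N : nat) (l : seq nat) : nat :=
  if l is v :: l' then v * N ^ size l' + index N l' else 0.

Lemma index_lt N l : all (fun v => v < N) l -> index N l < N ^ size l.
Proof.
elim: l => //= v l IH /andP[hv /IH hl].
rewrite expnS; apply: (@leq_trans (v * N ^ size l + N ^ size l)); first by rewrite ltn_add2l.
by rewrite addnC -mulSn leq_mul2r hv orbT.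
Qed.

Lemma index_inj N l l' : size l = size l' -> all (fun v => v < N) l ->
  all (fun v => v < N) l' -> index N l = index N l' -> l = l'.
Proof.
elim: l l' => [|v l IH] [|v' l'] //= [e] /andP[hv hl] /andP[hv' hl'].
have := index_lt hl; have := index_lt hl'; rewrite -e => i' i E.
have N0 : 0 < N ^ size l by apply: leq_ltn_trans i.
have ev : v = v'.
  by have := congr1 (divn^~ (N ^ size l)) E; rewrite !divnMDl // !divn_small // !addn0.
by move: E; rewrite ev => /addnI/(IH _ e hl hl')->.
Qed.

(* Tapes [0 .. q-1] hold copies of the input whose heads are the variables of
   the rules; [spare] and the [counter]s are further copies, used by the loops
   that move the head of [table]; the first cell of [change] tells whether the
   table has changed. *)
Definition spare : nat := q.
Definition counter (k : nat) : nat := q.+1 + k.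
Definition table : nat := q.+1 + r.
Definition change : nat := table.+1.
Definition work : nat := change.

Local Notation aux := (option {set pred}).
Local Notation cmd := (cmd A aux).
Local Notation state := (state A aux).
Local Notation cell := (cell A aux).
Definition mark : cell := Some (inr None).

(** * Running time up to powers of the input size *)

Section Input.
Variable w : seq A.
Let n := size w.
Let N := n.+2.

(* Time is bounded by powers of [N]: as [N >= 2], such bounds are closed under
   sums and products up to a change of exponent. *)
Definition within c (s : state) b s' k : Prop :=
  exists2 t, t <= N ^ k & exec work c s b s' t.

Lemma add_pow a b : N ^ a + N ^ b <= N ^ (a + b).+1.
Proof.
have ha : N ^ a <= N ^ (a + b) by rewrite leq_exp2l // leq_addr.
have hb : N ^ b <= N ^ (a + b) by rewrite leq_exp2l // leq_addl.
rewrite expnS; apply: leq_trans (leq_add ha hb) _.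
by rewrite addnn -mul2n leq_mul2r orbT.
Qed.

Lemma within_weaken c s b s' k k' :
  within c s b s' k -> k <= k' -> within c s b s' k'.
Proof.
by case=> t ht he hk; exists t => //; apply: leq_trans ht _; rewrite leq_exp2l.
Qed.

Lemma within_eq c s b s' s'' k :
  within c s b s' k -> s' = s'' -> within c s b s'' k.
Proof. by move=> h <-. Qed.

Lemma within_ite c c1 c2 s b s' b' s'' k k' : within c s b s' k ->
  within (if b then c1 else c2) s' b' s'' k' ->
  within (Ite c c1 c2) s b' s'' (k + k').+1.
Proof.
case=> t ht he [t' ht' he']; exists (t + t'); last exact: ExecIte he he'.
exact: leq_trans (leq_add ht ht') (add_pow _ _).
Qed.

Definition seqc (c c' : cmd) : cmd := Ite c c' c'.

Lemma within_seq c c' s b s' b' s'' k k' : within c s b s' k ->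
  within c' s' b' s'' k' -> within (seqc c c') s b' s'' (k + k').+1.
Proof. by move=> h h'; apply: within_ite h _; case: b. Qed.

(** The variant [d] bounds the number of rounds by [N ^ i], and a round costs at most
    [N ^ a + N ^ b]; the last evaluation of the test accounts for the final [a]. *)
Lemma within_while c c1 a b i (I : nat -> state -> Prop) (Q : state -> Prop) d s :
    (forall d s, I d s -> exists v s1, within c s v s1 a /\
       if v then exists v2 s2 d', [/\ within c1 s1 v2 s2 b, d' < d & I d' s2]
       else Q s1) ->
    d <= N ^ i -> I d s ->
  exists2 s', within (Wh c c1) s true s' (i + (a + b).+1 + a).+1 & Q s'.
Proof.
move=> step hd hs.
suff [t [s' [ht he hq]]] : exists t s', [/\ t <= d * (N ^ a + N ^ b) + N ^ a,
    exec work (Wh c c1) s true s' t & Q s'].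
  exists s' => //; exists t => //; apply: leq_trans ht _.
  apply: leq_trans (add_pow _ _); rewrite leq_add2r expnD.
  by apply: leq_mul => //; apply: add_pow.
elim/ltn_ind: d s hs {hd} => d IH s /step[[] [s1 [[t1 ht1 e1]]]]; last first.
  by move=> hq; exists t1, s1; split=> //; [rewrite (leq_trans ht1) ?leq_addl|exact: ExecWhF].
move=> [v2 [s2 [d' [[t2 ht2 e2] hd' /(IH _ hd')[t3 [s3 [ht3 e3 hq]]]]]]].
exists (t1 + (t2 + t3)), s3; split=> //; last exact: ExecWhT e1 e2 e3.
rewrite addnA; apply: leq_trans (leq_add (leq_add ht1 ht2) ht3) _.
by rewrite addnA -mulSn leq_add2r leq_mul2r hd' orbT.
Qed.

Definition test i b : cmd := Op i i (fun _ x => x) MStay b.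
Definition nop : cmd := test 0 predT.
Definition moveto i mv : cmd := Op i i (fun _ x => x) mv predT.
Definition write i f : cmd := Op i i (fun _ => f) MStay predT.
Definition copy i j : cmd := Op i j (fun x _ => x) MStay predT.

Lemma within_op i j f mv b s : i <= work -> j <= work -> (mv = MLeft -> 0 < ptr s j) ->
  within (Op i j f mv b) s (b (scan s i)) (op_state j (f (scan s i) (scan s j)) mv s) 0.
Proof. by move=> hi hj h; exists 1 => //; apply: ExecOp. Qed.

Lemma op_stateE j mv (s : state) : op_state j (scan s j) mv s =
  MkState (upd (ptr s) j (shift mv (ptr s j))) (cel s).
Proof. by rewrite /op_state; congr MkState; rewrite upd_id // upd_id. Qed.

Lemma within_test i b s : i <= work -> within (test i b) s (b (scan s i)) s 0.
Proof.
move=> hi; have := @within_op i i (fun _ x => x) MStay b s hi hi.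
by rewrite op_stateE upd_id //; case: s => p c; apply.
Qed.

Lemma within_nop s : within nop s true s 0.
Proof. exact: (@within_test 0 predT). Qed.

Lemma within_move i mv s : i <= work -> (mv = MLeft -> 0 < ptr s i) ->
  within (moveto i mv) s true (MkState (upd (ptr s) i (shift mv (ptr s i))) (cel s)) 0.
Proof. by move=> hi h; rewrite -op_stateE; apply: (@within_op i i _ mv predT). Qed.

Definition rewind i : cmd := Wh (test i (fun c => c != mark)) (moveto i MLeft).

Lemma within_rewind i k s : i <= work -> ptr s i <= N ^ k -> cel s i 0 = mark ->
    (forall p, cel s i p.+1 != mark) ->
  within (rewind i) s true (MkState (upd (ptr s) i 0) (cel s)) (k + 2).
Proof.
move=> hi hk h0 hS; case: s h0 hS hk => p c /= h0 hS hk.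
have [|//||s' h E] := @within_while (test i (fun x => x != mark)) (moveto i MLeft) 0 0
  k (fun d s => s = MkState (upd p i d) c) (fun s => s = MkState (upd p i 0) c)
  (p i) (MkState p c).
- move=> d _ ->; exists (0 < d), (MkState (upd p i d) c); split.
    have := @within_test i (fun x => x != mark) (MkState (upd p i d) c) hi.
    by rewrite /scan /= upd_same; case: d => [|d]; rewrite ?h0 ?eqxx ?hS.
  case: d => [|d] //=; exists true, (MkState (upd p i d) c), d; split=> //.
  have := @within_move i MLeft (MkState (upd p i d.+1) c) hi.
  by rewrite /= upd_same upd_upd; apply.
- by rewrite upd_id.
- by rewrite E in h; apply: within_weaken h _; lia.
Qed.

Definition str (k : nat) : cell := nth None (mark :: map (Some \o inl) w) k.

(** The empty set is stored as a blank, so that a fresh tape is the empty table once marked. Since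
    cell 0 holds the mark, entry [k] lies in cell [k + 1]. *)
Definition table_cell (T : nat -> {set pred}) (k : nat) : cell :=
  if k is k'.+1 then
    if T k' == set0 then None else Some (inr (Some (T k')))
  else mark.

(** During the evaluation the contents of the tapes depend only on the table and the flag; all else
    is in the head positions. *)
Definition config (p : nat -> nat) (T : nat -> {set pred}) (ch : bool) : state :=
  MkState p (fun i => if i < table then str else if i == table then table_cell T
                    else fun k => if [&& i == change, k == 0 & ch] then mark else None).

Lemma strS k : str k.+1 != mark.
Proof.
rewrite /str /=; have [hk|hk] := ltnP k (size w); last by rewrite nth_default ?size_map.
by case: w k hk => // a l k hk; rewrite (nth_map a).
Qed.

Lemma str_blank k : (str k == None) = (n < k).
Proof.
rewrite /str; case: k => // k /=; rewrite /n ltnS.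
have [hk|hk] := leqP (size w) k; first by rewrite nth_default ?size_map.
by case: w k hk => // a l k hk; rewrite (nth_map a).
Qed.

Lemma table_cellS T k : table_cell T k.+1 != mark.
Proof. by rewrite /=; case: ifP. Qed.

Lemma within_move_config i mv p T ch : i <= work -> (mv = MLeft -> 0 < p i) ->
  within (moveto i mv) (config p T ch) true (config (upd p i (shift mv (p i))) T ch) 0.
Proof. exact: (@within_move i mv (config p T ch)). Qed.

Lemma within_move_eq i mv p p' T ch : i <= work -> (mv = MLeft -> 0 < p i) ->
  upd p i (shift mv (p i)) = p' ->
  within (moveto i mv) (config p T ch) true (config p' T ch) 0.
Proof. by move=> hi h <-; apply: within_move_config. Qed.

Lemma within_rewind_config i k p T ch : i <= table -> p i <= N ^ k ->
  within (rewind i) (config p T ch) true (config (upd p i 0) T ch) (k + 2).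
Proof.
move=> hi hp; apply: within_rewind => //=; first exact: leqW.
  by case: ltnP => // hti; rewrite (_ : i == table) // eqn_leq hi.
move=> k'; case: ifP => _; first exact: strS.
by case: ifP => [_|]; [exact: table_cellS|rewrite ?andFb ?andbF].
Qed.

Lemma within_test_config i b v p T ch : i < table -> b (str (p i)) = v ->
  within (test i b) (config p T ch) v (config p T ch) 0.
Proof.
move=> hi <-; have := @within_test i b (config p T ch).
by rewrite /scan /= hi; apply; rewrite /work /change; lia.
Qed.

End Input.

(** * Addressing the table of facts *)

(** The loop passes over the mark and the letters, that is [size w + 1] nonblank cells; the call
    after the loop completes the [size w + 2] rounds that multiply the step by the base. *)
Fixpoint add_power (k : nat) : cmd :=
  if k is k'.+1 then
    seqc (Wh (test (counter k') (fun c => c != None))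
             (seqc (add_power k') (moveto (counter k') MRight)))
         (seqc (add_power k') (rewind (counter k')))
  else moveto table MRight.

Lemma within_add_power k : k <= r -> exists e, forall w p T ch,
  (forall j, j < k -> p (counter j) = 0) ->
  within w (add_power k) (config w p T ch) true
    (config w (upd p table (p table + (size w).+2 ^ k)) T ch) e.
Proof.
elim: k => [|k IH] hk /=.
  by exists 0 => w p T ch _; rewrite expn0 addn1; apply: within_move_config.
have [|e he] := IH; first by lia.
have hy : counter k < table by rewrite /counter /table; lia.
eexists=> w p T ch hp; set N := (size w).+2.
pose F v := config w (upd (upd p (counter k) v) table (p table + v * N ^ k)) T ch.
have hF v : within w (add_power k) (F v) true
    (config w (upd (upd p (counter k) v) table (p table + v.+1 * N ^ k)) T ch) e.
  have := he w (upd (upd p (counter k) v) table (p table + v * N ^ k)) T ch.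
  rewrite upd_same upd_upd -addnA mulSnr; apply=> j hj.
  by rewrite !upd_other ?hp //; rewrite /counter /table; lia.
have F0 : config w p T ch = F 0.
  by have hpk := hp k (ltnSn k); rewrite /F; congr config; updeq.
apply: within_seq.
  have [|||s' h E] := @within_while w (test (counter k) (fun c => c != None))
    (seqc (add_power k) (moveto (counter k) MRight)) 0 (e + 0).+1 1
    (fun d s => d <= (size w).+1 /\ s = F ((size w).+1 - d))
    (fun s => s = F (size w).+1) (size w).+1 (F 0).
  - move=> d _ [hd ->]; exists (0 < d), (F ((size w).+1 - d)); split.
      apply: within_test_config => //; rewrite str_blank.
      by updval.
    case: d hd => [|d] hd //=.
    exists true, (F ((size w).+1 - d)), d; split=> //; last by split=> //; lia.
    apply: within_seq (hF _) _.
    have := @within_move_config w (counter k) MRight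
      (upd (upd p (counter k) ((size w).+1 - d.+1)) table
        (p table + ((size w).+1 - d.+1).+1 * N ^ k)) T ch.
    rewrite [X in within _ _ _ true X _](_ : _ = F ((size w).+1 - d)); last first.
      rewrite /F; have -> : (size w).+1 - d = ((size w).+1 - d.+1).+1 by lia.
      by congr config; rewrite /=; updeq.
    by apply=> //; rewrite /work /change; lia.
  - by rewrite expn1.
  - by rewrite subnn.
  by rewrite F0; rewrite E in h; exact: h.
apply: within_seq (hF _) _.
have := @within_rewind_config w (counter k) 1
  (upd (upd p (counter k) (size w).+1) table (p table + (size w).+2 * N ^ k)) T ch (ltnW hy).
rewrite upd_other ?upd_same; last by rewrite neq_ltn hy.
rewrite [X in within _ _ _ true X _](_ : _ =
  config w (upd p table (p table + N ^ k.+1)) T ch); last first.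
  by have hpk := hp k (ltnSn k); congr config; rewrite expnS /N; updeq.
by apply; rewrite expn1.
Qed.

Lemma spare_lt : spare < table. Proof. by rewrite /spare /table; lia. Qed.
Lemma table_le : table <= work. Proof. exact: leqnSn. Qed.

(** Head [x] serves as the counter: it walks back to the mark while [spare] records the distance,
    and the second loop restores it from [spare]. *)
Definition repeat_add (x k : nat) : cmd :=
  seqc (Wh (test x (fun c => c != mark))
          (seqc (moveto x MLeft) (seqc (moveto spare MRight) (add_power k))))
       (Wh (test spare (fun c => c != mark))
          (seqc (moveto spare MLeft) (moveto x MRight))).

Lemma str_mark w k : (str w k != mark) = (0 < k).
Proof. by case: k => [|k]; rewrite ?strS. Qed.

Lemma within_repeat_add k : k <= r -> exists e, forall w p T ch x,
  x < q -> p x <= size w -> (forall i, q <= i < table -> p i = 0) ->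
  within w (repeat_add x k) (config w p T ch) true
    (config w (upd p table (p table + p x * (size w).+2 ^ k)) T ch) e.
Proof.
move=> hk; have [e he] := within_add_power hk.
eexists=> w p T ch x hx hpx hp; set N := (size w).+2.
have hz := spare_lt; have htK := table_le; have hxz : x < spare by [].
have hpz : p spare = 0 by apply: hp; rewrite leqnn hz.
pose F d t := config w (upd (upd (upd p x (p x - d)) spare d) table t) T ch.
have F0 : config w p T ch = F 0 (p table + 0 * N ^ k).
  by congr config; rewrite subn0; updeq.
apply: within_seq.
  have [|||s' h E] := @within_while w (test x (fun c => c != mark))
      (seqc (moveto x MLeft) (seqc (moveto spare MRight) (add_power k))) 0
      (0 + (0 + e).+1).+1 1
      (fun d s => d <= p x /\ s = F (p x - d) (p table + (p x - d) * N ^ k))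
      (fun s => s = F (p x) (p table + p x * N ^ k)) (p x) (F 0 (p table + 0 * N ^ k)).
  - move=> d _ [hd ->]; exists (0 < d), (F (p x - d) (p table + (p x - d) * N ^ k)); split.
      by apply: within_test_config; [lia|rewrite str_mark; updval].
    case: d hd => [|d] hd /=; first by rewrite subn0.
    exists true, (F (p x - d) (p table + (p x - d) * N ^ k)), d.
    split=> //; last by split=> //; lia.
    have -> : p x - d = (p x - d.+1).+1 by lia.
    apply: within_seq; first apply: within_move_config; try lia.
      by updval.
    apply: within_seq; first by apply: within_move_config => //; lia.
    set p1 := upd _ spare _; have := he w p1 T ch.
    rewrite (_ : upd p1 table _ = upd (upd (upd p x (p x - (p x - d.+1).+1))
      spare (p x - d.+1).+1) table
      (p table + (p x - d.+1).+1 * N ^ k)); first apply.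
      by move=> j hj; rewrite /p1 /counter !upd_other ?hp // /spare /table; lia.
    by rewrite /p1 /N; updeq.
  - by rewrite expn1; lia.
  - by rewrite subnn.
  by rewrite F0; rewrite E in h; exact: h.
have [|||s' h E] := @within_while w (test spare (fun c => c != mark))
    (seqc (moveto spare MLeft) (moveto x MRight)) 0 (0 + 0).+1 1
    (fun d s => d <= p x /\ s = F d (p table + p x * N ^ k))
    (fun s => s = F 0 (p table + p x * N ^ k)) (p x) (F (p x) (p table + p x * N ^ k)).
- move=> d _ [hd ->]; exists (0 < d), (F d (p table + p x * N ^ k)); split.
    by apply: within_test_config; [lia|rewrite str_mark; updval].
  case: d hd => [|d] hd //=.
  exists true, (F d (p table + p x * N ^ k)), d; split=> //; last by split=> //; lia.
  apply: within_seq; first apply: within_move_config; try lia.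
    by updval.
  by apply: within_move_eq => //; [lia|updeq].
- by rewrite expn1; lia.
- by [].
rewrite E in h; rewrite [X in within _ _ _ true X _](_ : _ =
  F 0 (p table + p x * N ^ k)); first exact: h.
by congr config; rewrite subn0; updeq.
Qed.
(** A successor term adds the power of its digit once more. The final move skips the mark in cell
    0. *)
Fixpoint seek (l : seq term) : cmd :=
  if l is u :: l' then
    seqc (repeat_add u.1 (size l'))
         (seqc (if u.2 then add_power (size l') else nop) (seek l'))
  else moveto table MRight.

Definition in_range (w : seq A) (p : nat -> nat) : Prop :=
  forall x, x < q -> p x <= size w.
Definition valid (w : seq A) (p : nat -> nat) : Prop :=
  in_range w p /\ forall i, q <= i -> p i = 0.

Lemma within_seek l : size l <= r -> all (fun u : term => u.1 < q) l ->
  exists e, forall w p T ch, in_range w p -> (forall i, q <= i < table -> p i = 0) ->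
  within w (seek l) (config w p T ch) true
    (config w (upd p table (p table + (index (size w).+2 (map (term_val p) l)).+1)) T ch) e.
Proof.
have htK := table_le; have qt : q < table by rewrite /table; lia.
elim: l => [|[x o] l IH] /= hs.
  by move=> _; exists 0 => w p T ch _ _; apply: within_move_eq => //=; rewrite addn1.
case/andP=> hx hl; have [e he] := IH (ltnW hs) hl.
have [e1 he1] := within_repeat_add (ltnW hs); have [e2 he2] := within_add_power (ltnW hs).
exists (e1 + (e2 + e).+1).+1 => w p T ch hp hz.
apply: within_seq; first by apply: he1 => //; apply: hp.
set p1 := upd p table _; set p2 := upd p1 table (p1 table + o * (size w).+2 ^ size l).
have p2E i : i != table -> p2 i = p i by move=> hi; rewrite /p2 /p1 !upd_other.
apply: (@within_seq _ _ _ _ true (config w p2 T ch)).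
  rewrite /p2; case: o {p2 p2E} => /=.
    rewrite mul1n; apply: he2 => j hj.
    by rewrite /p1 upd_other ?hz // /counter /table; lia.
  rewrite mul0n addn0 upd_id //; apply: within_weaken (within_nop _ _) _ => //.
have := he w p2 T ch; rewrite (_ : upd p2 table _ = upd p table (p table +
   (term_val p (x, o) * (size w).+2 ^ size [seq term_val p i | i <- l] +
       index (size w).+2 [seq term_val p i | i <- l]).+1)).
  apply; first by move=> y hy; rewrite p2E; [apply: hp|lia].
  by move=> i hi; rewrite p2E; [apply: hz|lia].
have -> : [seq term_val p2 i | i <- l] = [seq term_val p i | i <- l].
  apply/eq_in_map => u /(allP hl) hu; rewrite /term_val p2E //; lia.
by rewrite size_map /term_val /p2 /p1 /=; case: (o) => /=; updeq.
Qed.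

(** * Testing and recording facts *)

Definition flag (ch : bool) : cell := if ch then mark else None.

Lemma within_flag w p T ch ch' : p change = 0 ->
  within w (write change (fun _ => flag ch')) (config w p T ch) true (config w p T ch') 0.
Proof.
move=> hp; have hc : change <= work by [].
have := @within_op w change change (fun _ _ => flag ch') MStay predT (config w p T ch) hc hc.
rewrite (_ : op_state _ _ _ _ = config w p T ch'); first exact.
rewrite /op_state /config /= hp; congr MkState; first by rewrite upd_id.
apply: functional_extensionality => j; rewrite /upd.
case: (eqVneq j change) => [->|hj].
  rewrite /change ltnNge leqnSn /= gtn_eqF //.
  by apply: functional_extensionality => -[|k] /=; rewrite ?eqxx ?andbF.
by case: ifP => _ //; case: ifP => _ //.
Qed.

Definition has_fact (P : pred) (c : cell) : bool :=
  if c is Some (inr (Some X)) then P \in X else false.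
Definition add_fact (P : pred) (c : cell) : cell :=
  Some (inr (Some (P |: (if c is Some (inr (Some X)) then X else set0)))).

(** Rewinding would lose the value of the test, so the control keeps it: each branch rewinds, then
    returns its own constant. *)
Definition test_atom (a : atom) : cmd :=
  Ite (seqc (seek a.2) (test table (has_fact a.1)))
      (seqc (rewind table) nop) (seqc (rewind table) (test table pred0)).

Definition set_atom (a : atom) : cmd :=
  seqc (seek a.2)
    (Ite (test table (has_fact a.1)) (rewind table)
       (seqc (write table (add_fact a.1))
             (seqc (rewind table) (write change (fun _ => flag true))))).

Definition holds (w : seq A) (T : nat -> {set pred}) (p : nat -> nat) (a : atom) : bool :=
  a.1 \in T (index (size w).+2 (atom_args p a)).

Lemma has_fact_cell P T k : has_fact P (table_cell T k.+1) = (P \in T k).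
Proof. by rewrite /=; case: eqP => //= ->; rewrite inE. Qed.

Lemma atom_args_lt w p a : atom_wf a -> in_range w p ->
  all (fun v => v < (size w).+2) (atom_args p a).
Proof.
case/andP=> _ /allP ha hp; apply/allP => v /mapP[u hu ->].
have := hp _ (ha u hu); rewrite /term_val; case: u.2; lia.
Qed.

Lemma index_atom w p a : atom_wf a -> in_range w p ->
  index (size w).+2 (atom_args p a) < (size w).+2 ^ r.
Proof.
move=> ha hp; have := index_lt (atom_args_lt ha hp).
by rewrite size_map; case/andP: ha => /eqP->.
Qed.

Lemma within_scan_fact w p T ch i P : p table = i.+1 ->
  within w (test table (has_fact P)) (config w p T ch) (P \in T i) (config w p T ch) 0.
Proof.
move=> hi; have := @within_test w table (has_fact P) (config w p T ch) table_le.
by rewrite /scan /= ltnn eqxx hi has_fact_cell.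
Qed.

Lemma within_rewind_table w p T ch i : p table = 0 -> i < (size w).+2 ^ r ->
  within w (rewind table) (config w (upd p table i.+1) T ch) true (config w p T ch) (r + 2).
Proof.
move=> h0 hi; rewrite [X in within _ _ _ true X](_ : _ =
  config w (upd (upd p table i.+1) table 0) T ch).
  by apply: within_rewind_config; rewrite ?upd_same.
by rewrite upd_upd upd_id.
Qed.

Lemma valid_home w p : valid w p -> [/\ in_range w p,
  forall i, q <= i < table -> p i = 0 & p table = 0].
Proof.
case=> h1 h2; split=> //; first by move=> i /andP[hi _]; apply: h2.
by apply: h2; rewrite /table; lia.
Qed.

Lemma within_test_atom a : atom_wf a -> exists e, forall w p T ch, valid w p ->
  within w (test_atom a) (config w p T ch) (holds w T p a) (config w p T ch) e.
Proof.
move=> ha; have /andP[/eqP hs hall] := ha.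
have [|e he] := @within_seek a.2 _ hall; first by rewrite hs.
eexists=> w p T ch /valid_home[hp hz ht]; have hi := index_atom ha hp.
apply: within_ite.
  apply: within_seq; first by apply: he.
  rewrite ht add0n; apply: within_scan_fact; exact: upd_same.
rewrite -/(holds w T p a).
have hn : within w nop (config w p T ch) true (config w p T ch) 0 by apply: within_nop.
have hf : within w (test table pred0) (config w p T ch) false (config w p T ch) 0.
  exact: (within_test w pred0 (config w p T ch) table_le).
by case: (holds w T p a);
  (apply: within_seq; first exact: (within_rewind_table T ch ht hi)); [exact: hn|exact: hf].
Qed.

(* [X] pairs the table with the flag telling whether it has changed. *)
Definition put w p a (X : (nat -> {set pred}) * bool) :=
  if holds w X.1 p a then X else
  let i := index (size w).+2 (atom_args p a) in (upd X.1 i (a.1 |: X.1 i), true).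

Lemma within_set_atom a : atom_wf a -> exists e, forall w p X, valid w p ->
  exists b, within w (set_atom a) (config w p X.1 X.2) b
    (config w p (put w p a X).1 (put w p a X).2) e.
Proof.
move=> ha; have /andP[/eqP hs hall] := ha.
have [|e he] := @within_seek a.2 _ hall; first by rewrite hs.
exists (e + (0 + (0 + ((r + 2) + 0).+1).+1).+1).+1 => w p [T ch] hv.
have [hp hz ht] := valid_home hv; have hi := index_atom ha hp.
set i := index _ _ in hi; exists true.
apply: within_seq; first by apply: he.
rewrite ht add0n -/(atom_args p a) -/i; apply: within_ite.
  apply: within_scan_fact; exact: upd_same.
rewrite /put /holds -/i /=; case: (a.1 \in T i) => /=.
  by apply: within_weaken (within_rewind_table T ch ht hi) _; lia.
apply: (@within_seq _ _ _ _ true (config w (upd p table i.+1) (upd T i (a.1 |: T i)) ch)).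
  have := @within_op w table table (fun _ => add_fact a.1) MStay predT
    (config w (upd p table i.+1) T ch) table_le table_le.
  rewrite (_ : op_state _ _ _ _ = config w (upd p table i.+1) (upd T i (a.1 |: T i)) ch).
    exact.
  rewrite /op_state /config /scan /= ltnn eqxx upd_same upd_id ?upd_same //.
  congr MkState; apply: functional_extensionality => j; rewrite /upd.
  case: (eqVneq j table) => [->|hj]; last by case: ifP.
  rewrite ltnn; apply: functional_extensionality => -[|k] //=; rewrite eqSS.
  have hne : (a.1 |: T i == set0) = false.
    by apply/eqP => /setP/(_ a.1); rewrite !inE eqxx.
  by case: eqVneq => [_|//]; rewrite /add_fact hne; case: (eqVneq (T i) set0) => [->|].
apply: within_seq; first by apply: within_rewind_table.
by apply: (@within_flag w p _ ch true); apply: hv.2; rewrite /change /table; lia.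
Qed.

(** * Saturation of the table *)

Definition closed_at (w : seq A) (rl : rule) (p : nat -> nat) (T : nat -> {set pred}) : Prop :=
  (forall g, g \in rl.1.1 -> letter w (p g.1) = g.2) ->
  (forall a, a \in rl.1.2 -> holds w T p a) -> holds w T p rl.2.

Definition sound (w : seq A) (T : nat -> {set pred}) : Prop :=
  forall P l, size l = r -> all (fun v => v < (size w).+2) l ->
    P \in T (index (size w).+2 l) -> derives rules w P l.

Definition weight (w : seq A) (T : nat -> {set pred}) : nat :=
  \sum_(k < (size w).+2 ^ r) #|T k|.

(** Specification of a stretch of the evaluation: a flag down at the end certifies that nothing
    changed and that [Z] holds; a flag raised meanwhile certifies that a new fact was stored. *)
Definition progress w (Z : (nat -> {set pred}) -> Prop)
    (X X' : (nat -> {set pred}) * bool) : Prop :=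
  [/\ sound w X.1 -> sound w X'.1, weight w X.1 <= weight w X'.1,
      X'.2 = false -> X' = X /\ Z X.1
    & X'.2 -> X.2 \/ weight w X.1 < weight w X'.1].

Lemma progress_id w (Z : (nat -> {set pred}) -> Prop) X :
  (X.2 = false -> Z X.1) -> progress w Z X X.
Proof. by move=> h; split=> // [e|->]; [split=> //; apply: h|left]. Qed.

(** If the flag is down at the end, it was down in the middle, so [Z] and [Z'] concern the same
    table. *)
Lemma progress_comp w Z Z' X X' X'' : progress w Z X X' -> progress w Z' X' X'' ->
  progress w (fun T => Z T /\ Z' T) X X''.
Proof.
move=> [s l c d] [s' l' c' d']; split.
- by move=> /s/s'.
- exact: leq_trans l l'.
- by move=> h; have [e z'] := c' h; have [|e' z] := c; [rewrite -e|subst].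
- move=> /d'[/d[]|h]; first by left.
  + by move=> h; right; apply: leq_trans h l'.
  + by right; apply: leq_ltn_trans l h.
Qed.

Lemma progress_weaken w (Z Z' : (nat -> {set pred}) -> Prop) X X' :
  (forall T, Z T -> Z' T) -> progress w Z X X' -> progress w Z' X X'.
Proof. by move=> h [? ? c ?]; split=> // /c[e /h]. Qed.

Definition apply_rule w rl p (X : (nat -> {set pred}) * bool) :=
  if all (fun g : guard => letter w (p g.1) == g.2) rl.1.1 && all (holds w X.1 p) rl.1.2
  then put w p rl.2 X else X.

Lemma progress_rule w rl p X : rl \in rules -> rule_wf rl -> valid w p ->
  progress w (closed_at w rl p) X (apply_rule w rl p X).
Proof.
move=> hrl /and3P[_ hb hh] hv; have [hp _ _] := valid_home hv.
have hpA x : p x <= size w.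
  by have [/hp//|hx] := ltnP x q; rewrite hv.2.
rewrite /apply_rule; case: ifP => [/andP[hg ha]|hF]; last first.
  apply: progress_id => _ hg ha; case/negP: hF; apply/andP; split; apply/allP => u hu.
    by apply/eqP/hg.
  exact: ha.
rewrite /put; case: ifP => [hh1|hh1]; first by apply: progress_id => _ _ _.
set i := index _ _; have hi : i < (size w).+2 ^ r by apply: index_atom.
have hlt : weight w X.1 < weight w (upd X.1 i (rl.2.1 |: X.1 i)).
  rewrite /weight (bigD1 (Ordinal hi)) //= [X in _ < X](bigD1 (Ordinal hi)) //= upd_same.
  rewrite cardsU1 -/i (_ : _ \notin _) ?addSn ?ltnS; last by rewrite /holds in hh1; rewrite hh1.
  rewrite leq_add2l; apply: leq_sum => j hj; rewrite upd_other //.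
split=> //=; [|exact: ltnW|by right].
move=> hs P l hl hlN; rewrite /upd; case: eqP => [e|_]; last exact: hs.
rewrite in_setU1 => /orP[/eqP->|]; last by rewrite -e; apply: hs.
(* Addresses are injective, so the fact just stored can only be read back as the head of the
   rule. *)
have -> : l = atom_args p rl.2.
  apply: index_inj hlN (atom_args_lt hh hp) e.
  by rewrite hl size_map; case/andP: hh => /eqP.
apply: DerivesRule => // [g hg1|a ha1]; first by apply/eqP; apply: (allP hg).
have wa := allP hb _ ha1; apply: hs; first by rewrite size_map; case/andP: wa => /eqP.
  exact: atom_args_lt.
exact: (allP ha).
Qed.

Definition test_guard (g : guard) : cmd :=
  test g.1 (fun c => c == if g.2 is Some a then Some (inl a) else mark).

Definition run_rule (rl : rule) : cmd :=
  foldr (fun g c => Ite (test_guard g) c nop)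
    (foldr (fun a c => Ite (test_atom a) c nop) (set_atom rl.2) rl.1.2) rl.1.1.

Lemma str_letter w k a : k <= size w ->
  (str w k == if a is Some b then Some (inl b) else mark) = (letter w k == a).
Proof.
case: k => [|k] hk; first by case: a.
rewrite /str /letter /=; case: w hk => // b w hk.
by rewrite !(nth_map b) //; case: a.
Qed.

Lemma within_run_rule rl : rule_wf rl -> exists e, forall w p X, valid w p ->
  exists b, within w (run_rule rl) (config w p X.1 X.2) b
    (config w p (apply_rule w rl p X).1 (apply_rule w rl p X).2) e.
Proof.
case: rl => [[gs bs] h] /and3P[/= hg hb hh]; rewrite /run_rule /apply_rule /=.
elim: gs hg => [_|g gs IH /andP[hg /IH[e he]]] /=.
  elim: bs hb => [_|a bs IH /andP[ha /IH[e he]]] /=; first exact: within_set_atom.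
  have [e1 he1] := within_test_atom ha.
  exists (e1 + e).+1 => w p X hv; have := he1 w p X.1 X.2 hv.
  case: (holds w X.1 p a) => h1; last first.
    exists true; apply: within_ite h1 _.
    by apply: within_weaken (within_nop _ _) _.
  by have [b hb'] := he w p X hv; exists b; apply: within_ite h1 hb'.
exists (0 + e).+1 => w p X hv; have [hp _ _] := valid_home hv.
have h1 : within w (test_guard g) (config w p X.1 X.2) (letter w (p g.1) == g.2)
    (config w p X.1 X.2) 0.
  apply: within_test_config; first by rewrite /table; lia.
  by rewrite str_letter // hp.
case: (letter w (p g.1) == g.2) h1 => h1 /=.
  by have [b hb'] := he w p X hv; exists b; apply: within_ite h1 hb'.
exists true; apply: within_ite h1 _.
by apply: within_weaken (within_nop _ _) _.
Qed.

Definition run_rules (l : seq rule) : cmd :=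
  foldr (fun rl c => seqc (run_rule rl) c) nop l.

Lemma within_run_rules l : {subset l <= rules} -> all rule_wf l ->
  exists e, forall w p X, valid w p -> exists b X',
    within w (run_rules l) (config w p X.1 X.2) b (config w p X'.1 X'.2) e /\
    progress w (fun T => forall rl, rl \in l -> closed_at w rl p T) X X'.
Proof.
elim: l => [_ _|rl l IH hl /= /andP[hrl /IH[|e he]]].
- exists 0 => w p X _; exists true, X; split; first exact: within_nop.
  by apply: progress_id.
- by move=> x hx; apply: hl; rewrite inE hx orbT.
have [e1 he1] := within_run_rule hrl; exists (e1 + e).+1 => w p X hv.
have [b1 h1] := he1 w p X hv.
have [b [X' [h2 pr]]] := he w p (apply_rule w rl p X) hv.
exists b, X'; split; first exact: within_seq h1 h2.
have pr1 : progress w (closed_at w rl p) X (apply_rule w rl p X).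
  by apply: progress_rule => //; apply: hl; rewrite inE eqxx.
apply: progress_weaken (progress_comp pr1 pr) => T [z1 z2] x.
by rewrite inE => /orP[/eqP->|/z2].
Qed.

(** One nested loop per variable: its head visits the positions 0 to [size w], stops on the first
    blank and goes home. *)
Fixpoint sweep (k : nat) (c : cmd) : cmd :=
  if k is k'.+1 then
    seqc (Wh (test k' (fun x => x != None)) (seqc (sweep k' c) (moveto k' MRight)))
         (rewind k')
  else c.

Lemma within_sweep k c (Z : seq A -> (nat -> nat) -> (nat -> {set pred}) -> Prop) :
    (exists e, forall w p X, valid w p -> exists b X',
      within w c (config w p X.1 X.2) b (config w p X'.1 X'.2) e /\
      progress w (Z w p) X X') -> k <= q ->
  exists e, forall w p X, valid w p -> (forall i, i < k -> p i = 0) ->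
    exists b X',
      within w (sweep k c) (config w p X.1 X.2) b (config w p X'.1 X'.2) e /\
      progress w (fun T => forall p', valid w p' ->
        (forall i, k <= i -> p' i = p i) -> Z w p' T) X X'.
Proof.
case=> e0 he0; elim: k => [_|k IH hk] /=.
  exists e0 => w p X hv _; have [b [X' [h pr]]] := he0 w p X hv; exists b, X'; split=> //.
  apply: progress_weaken pr => T hT p' _ hp'; rewrite (_ : p' = p) //.
  by apply: functional_extensionality => i; apply: hp'.
have [e he] := IH (ltnW hk).
have kt : k < table by rewrite /table; lia.
have ktK : k <= work by rewrite /work /change; lia.
eexists => w p X hv hp0; have p0 : p k = 0 by apply: hp0.
(* With [d] rounds left, the values of variable [k] below [(size w).+1 - d] have been swept. *)
pose I d s := d <= (size w).+1 /\ exists X',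
  s = config w (upd p k ((size w).+1 - d)) X'.1 X'.2 /\
  progress w (fun T => forall p', valid w p' -> (forall i, k < i -> p' i = p i) ->
    p' k < (size w).+1 - d -> Z w p' T) X X'.
pose Q s := exists X', s = config w (upd p k (size w).+1) X'.1 X'.2 /\
  progress w (fun T => forall p', valid w p' -> (forall i, k < i -> p' i = p i) ->
    Z w p' T) X X'.
have [|||s' h [X' [E pr]]] := @within_while w (test k (fun x => x != None))
    (seqc (sweep k c) (moveto k MRight)) 0 (e + 0).+1 1 I Q (size w).+1 (config w p X.1 X.2).
- move=> d _ [hd [X' [-> pr]]].
  exists (0 < d), (config w (upd p k ((size w).+1 - d)) X'.1 X'.2); split.
    by apply: within_test_config => //; rewrite str_blank upd_same; lia.
  case: d hd pr => [|d] hd pr /=.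
    exists X'; split; first by rewrite subn0.
    apply: progress_weaken pr => T hT p' hp' hi; apply: hT => //.
    by rewrite subn0 ltnS; apply: hp'.1.
  have hv1 : valid w (upd p k ((size w).+1 - d.+1)).
    case: hv => hv1 hv2; split=> [x hx|i hi]; rewrite /upd; case: eqP => //; try lia.
      by move=> _; apply: hv1.
    by move=> _; apply: hv2.
  have [|b [X'' [h1 pr1]]] := he w _ X' hv1.
    by move=> i hi; rewrite upd_other ?hp0 //; lia.
  exists true, (config w (upd p k ((size w).+1 - d)) X''.1 X''.2), d; split=> //.
    apply: within_seq h1 _; apply: within_move_eq => //.
    by rewrite upd_same upd_upd /=; congr upd; lia.
  split; first by lia.
  exists X''; split=> //; apply: progress_weaken (progress_comp pr pr1).
  move=> T [hT hT1] p' hp' hi hlt.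
  have [hk'|hk'] := ltnP (p' k) ((size w).+1 - d.+1); first by apply: hT.
  apply: hT1 => // i hi'; rewrite /upd; case: eqP => [->|hn]; first by lia.
  by apply: hi; lia.
- by rewrite expn1.
- split=> //; exists X; split; first by rewrite subnn upd_id.
  by apply: progress_id => _ p' _ _; rewrite subnn.
exists true, X'; split=> //; apply: within_seq h _; rewrite E.
have := @within_rewind_config w k 1 (upd p k (size w).+1) X'.1 X'.2 (ltnW kt).
by rewrite upd_same upd_upd expn1 (upd_id p0); apply.
Qed.

Definition all_closed w (T : nat -> {set pred}) : Prop :=
  forall p, valid w p -> forall rl, rl \in rules -> closed_at w rl p T.

(** Every sweep but the last stores a new fact, so the room left in the table is a variant of this
    loop. *)
Definition saturate : cmd :=
  Wh (seqc (write change (fun _ => flag false))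
           (seqc (sweep q (run_rules rules)) (test change (fun c => c == mark)))) nop.

Lemma within_test_flag w p T ch : p change = 0 ->
  within w (test change (fun c => c == mark)) (config w p T ch) ch (config w p T ch) 0.
Proof.
move=> hp; have := @within_test w change (fun c => c == mark) (config w p T ch) (leqnn _).
rewrite /scan /= hp eqxx /change ltnNge leqnSn /= gtn_eqF //=.
by case: ch.
Qed.

Lemma weight_le w T : weight w T <= (size w).+2 ^ r * #|pred|.
Proof.
apply: (@leq_trans (\sum_(k < (size w).+2 ^ r) #|pred|)).
  by apply: leq_sum => i _; apply: max_card.
by rewrite sum_nat_const card_ord.
Qed.

Definition home : nat -> nat := fun _ => 0.

Lemma valid0 w : valid w home. Proof. by []. Qed.

Lemma within_saturate : all rule_wf rules -> exists e, forall w T ch, sound w T ->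
  exists T' ch', [/\ within w saturate (config w home T ch) true (config w home T' ch') e,
    sound w T' & all_closed w T'].
Proof.
move=> hwf; have [||e he] := @within_sweep q (run_rules rules)
  (fun w p T => forall rl, rl \in rules -> closed_at w rl p T) => //.
  by have [//|e he] := @within_run_rules rules _ hwf; exists e.
exists (r + #|pred| + ((0 + (e + 0).+1).+1 + 0).+1 + (0 + (e + 0).+1).+1).+1 => w T ch hs.
pose B := (size w).+2 ^ r * #|pred|.
have hB T' : weight w T' <= B := weight_le w T'.
pose I d s := exists T' ch', [/\ s = config w home T' ch', sound w T' & d = B - weight w T'].
pose Q s := exists T' ch', [/\ s = config w home T' ch', sound w T' & all_closed w T'].
have [|||s' h [T' [ch' [E sT cT]]]] := @within_while w
    (seqc (write change (fun _ => flag false))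
           (seqc (sweep q (run_rules rules)) (test change (fun c => c == mark)))) nop
    (0 + (e + 0).+1).+1 0 (r + #|pred|) I Q (B - weight w T) (config w home T ch).
- move=> d _ [T' [ch' [-> sT ->]]].
  have [|b [X' [h pr]]] := he w home (T', false) (valid0 w); first by [].
  exists X'.2, (config w home X'.1 X'.2); split.
    apply: within_seq; first exact: within_flag.
    by apply: within_seq h _; apply: within_test_flag.
  case: pr => /= [ps _ pc pm]; case e2: X'.2 in pc pm *.
    have [//|hlt] := pm isT; exists true, (config w home X'.1 true), (B - weight w X'.1).
    split; first exact: within_nop.
      by have := hB X'.1; lia.
    by exists X'.1, true; split=> //; apply: ps.
  have [-> z] := pc erefl; exists T', false; split=> //.
  by move=> p hp; apply: z => // i hi; rewrite hp.2.
(* The constant [#|pred|] is bounded by a power of the base, like any other factor. *)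
- rewrite expnD; apply: leq_trans (leq_subr _ _) _; apply: leq_mul => //.
  exact/ltnW/ltn_expl.
- by exists T, ch.
by exists T', ch'; rewrite -E.
Qed.

Lemma derives_closed w T : all rule_wf rules -> all_closed w T ->
  forall P l, derives rules w P l -> P \in T (index (size w).+2 l).
Proof.
move=> hwf hT P l; elim=> {P l} rl rho hrl hrho hg _ IH.
(* Well-formed rules mention only variables below [q]; cutting the valuation there makes it a
   position of the heads. *)
pose p i := if i < q then rho i else 0.
have hp : valid w p.
  by split=> [x hx|i hi]; rewrite /p ?hx // ltnNge hi.
have pE a : atom_wf a -> atom_args p a = atom_args rho a.
  case/andP=> _ /allP ha; apply/eq_in_map => u /ha hu.
  by rewrite /term_val /p hu.
have /and3P[/allP wg /allP wb wh] := allP hwf _ hrl.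
have := hT p hp rl hrl; rewrite /closed_at /holds pE //; apply.
  by move=> g hgg; rewrite /p (wg _ hgg); apply: hg.
by move=> a ha; rewrite pE; [apply: IH|apply: wb].
Qed.

(** * Copying the input *)

Definition copy_input (j : nat) : cmd :=
  seqc (write j (fun _ => mark)) (seqc (moveto 0 MRight) (seqc (moveto j MRight)
    (seqc (Wh (test 0 (fun x => x != None))
             (seqc (copy 0 j) (seqc (moveto 0 MRight) (moveto j MRight))))
          (seqc (rewind 0) (rewind j))))).

Fixpoint copies (k : nat) : cmd :=
  if k is k'.+1 then seqc (copies k') (copy_input k'.+1) else nop.

Definition prepare : cmd :=
  seqc (moveto 0 MLeft) (seqc (write 0 (fun _ => mark))
    (seqc (write table (fun _ => mark)) (copies (q + r)))).

Definition copied (w : seq A) (j : nat) : state :=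
  MkState home (fun i => if i < j then str w else
    if i == table then table_cell (fun _ => set0) else fun _ => None).

Lemma within_write w i f s : i <= work ->
  within w (write i f) s true
    (MkState (ptr s) (upd (cel s) i (upd (cel s i) (ptr s i) (f (scan s i))))) 0.
Proof.
move=> hi; have := @within_op w i i (fun _ => f) MStay predT s hi hi.
by rewrite /op_state /= (@upd_id _ (ptr s)) //; apply.
Qed.

Lemma within_copy_input : exists e, forall w j, 0 < j < table ->
  within w (copy_input j) (copied w j) true (copied w j.+1) e.
Proof.
eexists=> w j /andP[j0 hj].
have hjK : j <= work by rewrite /work /change; lia.
have h0j : 0 != j by rewrite eq_sym -lt0n.
(* The copying loop when the first [v] cells of tape [j] are in place. *)
pose F v := MkState (fun i => if (i == 0) || (i == j) then v else 0)
  (fun i => if i == j then fun k => if k < v then str w k else None else cel (copied w j) i).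
have F0 i v : i != j -> cel (F v) i = cel (copied w j) i.
  by move=> /negbTE h; rewrite /F /= h.
have c0 : cel (copied w j) 0 = str w by rewrite /= j0.
apply: within_seq; first exact: within_write.
apply: within_seq; first exact: within_move.
apply: within_seq; first exact: within_move.
rewrite [X in within _ _ X](_ : _ = F 1); last first.
  congr MkState; apply: functional_extensionality => i /=.
    by rewrite /upd /home; do ![case: eqP] => *; subst.
  rewrite /upd; case: (eqVneq i j) => // _; rewrite ltnn ltn_eqF //.
  by apply: functional_extensionality => -[|k].
apply: within_seq.
  have [|||s' h E] := @within_while w (test 0 (fun x => x != None))
    (seqc (copy 0 j) (seqc (moveto 0 MRight) (moveto j MRight)))
    0 (0 + (0 + 0).+1).+1 1 (fun d s => d <= size w /\ s = F ((size w).+1 - d))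
    (fun s => s = F (size w).+1) (size w) (F 1).
  - move=> d _ [hd ->]; exists (0 < d), (F ((size w).+1 - d)); split.
      have := @within_test w 0 (fun x => x != None) (F ((size w).+1 - d)) (leq0n _).
      rewrite /scan F0 // c0 /= str_blank (_ : (_ < _) = ~~ (0 < d)) ?negbK //; lia.
    case: d hd => [|d] hd //=.
    exists true, (F ((size w).+1 - d)), d; split=> //; last by split=> //; lia.
    have -> : (size w).+1 - d = ((size w).+1 - d.+1).+1 by lia.
    set v := (size w).+1 - d.+1.
    apply: within_eq.
      apply: within_seq; first exact: within_op.
      by apply: within_seq; apply: within_move.
    rewrite /op_state /F; congr MkState; apply: functional_extensionality => i /=.
      by rewrite /upd; do ![case: eqP] => *; subst.
    rewrite /upd; case: (eqVneq i j) => // _.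
    apply: functional_extensionality => k; rewrite eqxx orbT /scan /= (negbTE h0j) j0 ltnS.
    by rewrite [k <= v]leq_eqVlt; case: (eqVneq k v) => [->|].

  - by rewrite expn1; lia.
  - by split=> //; congr F; lia.
  rewrite E in h; exact: h.
have FS k : cel (F (size w).+1) j k = str w k.
  rewrite /F /= eqxx ltnS; case: leqP => // hk.
  by apply/esym/eqP; rewrite str_blank.
apply: within_eq.
  apply: within_seq; apply: (@within_rewind _ _ 1) => //=; rewrite ?eqxx ?orbT //.
  - by rewrite (negbTE h0j) j0.
  - by move=> p; rewrite (negbTE h0j) j0; apply: strS.
  - by rewrite upd_other 1?eq_sym // eqxx orbT.
  - by move=> p; case: ifP => // _; apply: strS.
congr MkState; apply: functional_extensionality => i /=.
  by rewrite /upd /home; do ![case: eqP] => *; subst.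
case: (eqVneq i j) => [->|hij].
  by rewrite leqnn; apply: functional_extensionality => k; rewrite -[RHS]FS /= eqxx.
by rewrite ltnS [i <= j]leq_eqVlt (negbTE hij).
Qed.

Lemma within_copies k : k <= q + r -> exists e, forall w,
  within w (copies k) (copied w 1) true (copied w k.+1) e.
Proof.
elim: k => [_|k IH hk] /=; first by exists 0 => w; apply: within_nop.
have [e he] := IH (ltnW hk); have [e1 he1] := within_copy_input.
exists (e + e1).+1 => w; apply: within_seq (he w) _; apply: he1.
by rewrite /table; lia.
Qed.

Lemma within_prepare : exists e, forall w,
  within w prepare (initial aux w) true (config w home (fun _ => set0) false) e.
Proof.
have [e he] := within_copies (leqnn _).
eexists=> w; apply: within_seq; first by apply: within_move.
apply: within_seq; first by apply: within_write.
apply: within_seq; first by apply: within_write; apply: table_le.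
apply: within_eq.
  rewrite [X in within _ _ X](_ : _ = copied w 1); first exact: he.
  congr MkState; apply: functional_extensionality => i /=.
    by rewrite /upd; case: eqP => // /eqP/negbTE->.
  have t0 : table != 0 by rewrite /table; lia.
  rewrite /upd; case: (eqVneq i table) => [->|hi].
    rewrite (negbTE t0) ltnS leqn0 (negbTE t0).
    by apply: functional_extensionality => -[|k] /=; rewrite ?eqxx.
  case: (eqVneq i 0) => [->|hi0]; last by rewrite ltnS leqn0 (negbTE hi0).
  by apply: functional_extensionality => -[|k] /=.
rewrite /copied /config /table addSn; congr MkState; apply: functional_extensionality => i.
case: ifP => // _; case: ifP => // _.
by apply: functional_extensionality => k; rewrite !andbF.
Qed.

(** Soundness of the stored facts gives one direction, closure under the rules the other. *)
Lemma derives_answered (goal : pred) : 0 < q -> all rule_wf rules ->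
  exists (c : cmd) (e : nat), forall w, exists b,
    (forall t, (size w).+2 ^ e <= t -> answers_within (machine work c) w t b) /\
    (b <-> derives rules w goal (nseq r 0)).
Proof.
move=> q0 hwf; have [e1 h1] := within_prepare; have [e2 h2] := within_saturate hwf.
have ha : atom_wf (goal, nseq r (0, false)).
  by rewrite /atom_wf /= size_nseq eqxx all_nseq q0 orbT.
have [e3 h3] := within_test_atom ha.
exists (seqc prepare (seqc saturate (test_atom (goal, nseq r (0, false))))).
exists (e1 + (e2 + e3).+1).+1 => w.
have s0 : sound w (fun _ => set0) by move=> P l _ _; rewrite inE.
have [T [ch [h2' sT cT]]] := h2 w _ false s0.
have h0 := h3 w home T ch (valid0 w).
exists (holds w T home (goal, nseq r (0, false))); split.
  have [t ht he] := within_seq (h1 w) (within_seq h2' h0) => t' ht'.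
  exact: exec_answers he (leq_trans ht ht').
rewrite /holds /atom_args /= map_nseq; split; last exact: derives_closed.
by apply: sT; rewrite ?size_nseq // all_nseq orbT.
Qed.

End Datalog.

Theorem datalog_ptime (A pred : finType) (q r : nat) (rules : seq (rule A pred))
    (goal : pred) (X : Type) (enc : X -> seq A) (P : X -> Prop) :
    0 < q -> all (rule_wf q r) rules ->
    (forall x, derives rules (enc x) goal (nseq r 0) <-> P x) ->
  decidable_in_ptime enc P.
Proof.
move=> q0 hwf hP; have [c [e he]] := derives_answered goal q0 hwf.
(* As [n + 2 <= 3 * n] for positive [n], the bound [(n + 2) ^ e] is at most [3 ^ e * n ^ e]; the
   additive [3 ^ e] covers the empty word. *)
exists (machine (q.+1 + r).+1 c), (3 ^ e), e => x.
have [b [hb hbd]] := he (enc x); exists b; split; last first.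
  by split=> [/hbd/hP|/hP/hbd].
apply: hb; have mono u v : u <= v -> u ^ e <= v ^ e.
  by move=> h; case: (e) => [|e0]; rewrite ?expn0 ?leq_exp2r.
have [->|n0] := posnP (size (enc x)).
  by apply: leq_trans (leq_addl _ _); apply: mono.
by apply: leq_trans (leq_addr _ _); rewrite -expnMn; apply: mono; lia.
Qed.

(** * Left-absorbing monomials *)

Lemma mem_leftmost m : leftmost m =i m.
Proof. by move=> v; rewrite /leftmost mem_rev mem_undup mem_rev. Qed.

Lemma leftmost_cat m n :
  leftmost (m ++ n) = leftmost m ++ [seq v <- leftmost n | v \notin m].
Proof.
rewrite /leftmost rev_cat undup_cat rev_cat filter_rev; congr (_ ++ rev _).
by apply: eq_filter => v; rewrite mem_rev.
Qed.

Lemma eq_absorb_mem m n : eq_absorb m n -> m =i n.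
Proof. by move=> e v; rewrite -mem_leftmost e mem_leftmost. Qed.

Lemma eq_absorb_cat m m' n n' :
  eq_absorb m m' -> eq_absorb n n' -> eq_absorb (m ++ n) (m' ++ n').
Proof.
move=> em en; rewrite /eq_absorb !leftmost_cat em en; congr (_ ++ _).
by apply: eq_filter => v; rewrite (eq_absorb_mem em).
Qed.

Lemma eq_absorb_catl m n : eq_absorb (m ++ n) m <-> {subset n <= m}.
Proof.
rewrite /eq_absorb leftmost_cat; split=> [e v hv|h].
  apply: contraT => hm; have : v \in [seq v <- leftmost n | v \notin m].
    by rewrite mem_filter hm mem_leftmost.
  by move/(congr1 size): e; rewrite size_cat; case: [seq _ <- _ | _] => //= ? ?; lia.
rewrite (eq_in_filter (a2 := pred0)) ?filter_pred0 ?cats0 // => v.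
by rewrite mem_leftmost => /h->.
Qed.

(** By induction from the right: one more letter either leaves the normal form unchanged or is
    appended to it. *)
Lemma prefix_leftmost l m :
  prefix l (leftmost m) -> exists2 b, b <= size m & l = leftmost (take b m).
Proof.
elim/last_ind: m => [|m v IH]; first by rewrite prefixs0 => /eqP->; exists 0.
have hm : prefix l (leftmost m) ->
    exists2 b, b <= size (rcons m v) & l = leftmost (take b (rcons m v)).
  by case/IH=> b hb ->; exists b; rewrite ?size_rcons ?(leqW hb) // -cats1 takel_cat.
rewrite -cats1 leftmost_cat /=; case: ifP => hv; last by rewrite cats0 cats1.
rewrite prefixE; have [hl|hl] := leqP (size l) (size (leftmost m)).
  by rewrite takel_cat // -prefixE cats1.
rewrite take_oversize ?size_cat ?addn1 // => /eqP<-.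
exists (size m).+1; first by rewrite ?size_rcons ?size_cat ?addn1.
by rewrite take_oversize ?size_cat ?size_rcons ?addn1 // -?[rcons m v]cats1 leftmost_cat /= hv.
Qed.

(** Whatever can still be completed to [M] amounts to a prefix of [M]: this is why polynomially many
    states suffice. *)
Lemma eq_absorb_prefix M n n' : eq_absorb (n ++ n') M ->
  exists b, eq_absorb n (take b M).
Proof.
rewrite /eq_absorb leftmost_cat => e; have [|b _ ->] := @prefix_leftmost (leftmost n) M.
  by rewrite -e prefix_prefix.
by exists b.
Qed.

(** * The Datalog program *)

(** The first three predicates parse names and concepts; [State], [Before] and [Skip] describe the
    prefixes of the monomial, their letters, and the stretches that they absorb; [Annot] is the
    action of an annotation on prefixes. The next four relate a node or role, a place in the input,
    and the prefixes before and after. *)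
Inductive kind :=
| NameEnd | SameName | ConceptEnd | State | Before | Skip | Annot
| Named | Conc | Role | Succ | Goal.

Definition kind_enum : seq kind :=
  [:: NameEnd; SameName; ConceptEnd; State; Before; Skip; Annot;
      Named; Conc; Role; Succ; Goal].

Definition kind_code (k : kind) : nat :=
  match k with
  | NameEnd => 0 | SameName => 1 | ConceptEnd => 2 | State => 3 | Before => 4
  | Skip => 5 | Annot => 6 | Named => 7 | Conc => 8 | Role => 9 | Succ => 10
  | Goal => 11
  end.

Lemma kind_codeK : cancel kind_code (nth Goal kind_enum).
Proof. by case. Qed.

HB.instance Definition _ := Countable.copy kind (can_type kind_codeK).

Lemma kind_enumP : Finite.axiom kind_enum.
Proof. by case. Qed.

HB.instance Definition _ := isFinite.Build kind kind_enumP.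

(* [v x] is the variable [x], [s x] its successor.  All predicates are given
   four arguments, by repetition of the first one.  Rules are referred to by
   their rank. *)
Definition derivation_rules : seq (rule symbol kind) :=
  let v x : term := (x, false) in
  let s x : term := (x, true) in
  let F k (l : seq term) : atom kind :=
    (k, [:: nth (0, false) l 0; nth (nth (0, false) l 0) l 1;
            nth (nth (0, false) l 0) l 2; nth (nth (0, false) l 0) l 3]) in
  let G x a : guard symbol := (x, Some a) in
  let Z x : guard symbol := (x, None) in
  let R (gs : seq (guard symbol)) (bs : seq (atom kind)) (h : atom kind) : rule symbol kind
    := (gs, bs, h) in
  [:: (* 0 *) R [:: G 0 SEnd] [::] (F NameEnd [:: v 0; s 0]);
      (* 1 *) R [:: G 0 (SBit true)] [:: F NameEnd [:: s 0; v 1]]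
                (F NameEnd [:: v 0; v 1]);
      (* 2 *) R [:: G 0 (SBit false)] [:: F NameEnd [:: s 0; v 1]]
                (F NameEnd [:: v 0; v 1]);
      (* 3 *) R [:: G 0 SEnd; G 1 SEnd] [::] (F SameName [:: v 0; v 1]);
      (* 4 *) R [:: G 0 (SBit true); G 1 (SBit true)]
                [:: F SameName [:: s 0; s 1]] (F SameName [:: v 0; v 1]);
      (* 5 *) R [:: G 0 (SBit false); G 1 (SBit false)]
                [:: F SameName [:: s 0; s 1]] (F SameName [:: v 0; v 1]);
      (* 6 *) R [:: G 0 STop] [::] (F ConceptEnd [:: v 0; s 0]);
      (* 7 *) R [:: G 0 SName] [:: F NameEnd [:: s 0; v 1]]
                (F ConceptEnd [:: v 0; v 1]);
      (* 8 *) R [:: G 0 SEx]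
                [:: F NameEnd [:: s 0; v 1]; F ConceptEnd [:: v 1; v 2]]
                (F ConceptEnd [:: v 0; v 2]);
      (* 9 *) R [:: G 0 SAnd]
                [:: F ConceptEnd [:: s 0; v 1]; F ConceptEnd [:: v 1; v 2]]
                (F ConceptEnd [:: v 0; v 2]);
      (* 10 *) R [:: Z 0] [:: F NameEnd [:: s 0; v 1]; F NameEnd [:: v 1; v 2]]
                 (F State [:: v 2]);
      (* 11 *) R [:: G 0 SVar] [:: F State [:: v 0]; F NameEnd [:: s 0; v 1]]
                 (F State [:: v 1]);
      (* 12 *) R [:: G 0 SVar] [:: F State [:: v 0]; F NameEnd [:: s 0; v 1]]
                 (F Before [:: v 0; v 1]);
      (* 13 *) R [:: G 1 SVar] [:: F Before [:: v 0; v 1]; F NameEnd [:: s 1; v 2]]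
                 (F Before [:: v 0; v 2]);
      (* 14 *) R [:: Z 0; G 2 SSep] [:: F Before [:: v 1; v 2]]
                 (F Before [:: v 1; v 0]);
      (* 15 *) R [::] [:: F State [:: v 0]] (F Skip [:: v 0; v 0]);
      (* 16 *) R [:: G 1 SVar]
                 [:: F Skip [:: v 0; v 1]; F Before [:: v 2; v 1];
                     F SameName [:: s 2; s 1]; F NameEnd [:: s 1; v 3]]
                 (F Skip [:: v 0; v 3]);
      (* 17 *) R [:: G 0 SOne] [::] (F Annot [:: v 0; v 1; v 1]);
      (* 18 *) R [:: G 0 SVar]
                 [:: F Before [:: v 1; v 2]; F SameName [:: s 1; s 0]]
                 (F Annot [:: v 0; v 2; v 2]);
      (* 19 *) R [:: G 0 SVar; G 1 SVar]
                 [:: F Skip [:: v 2; v 1]; F SameName [:: s 1; s 0];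
                     F NameEnd [:: s 1; v 3]]
                 (F Annot [:: v 0; v 2; v 3]);
      (* 20 *) R [:: Z 0; G 1 SSep] [:: F Skip [:: v 2; v 1]]
                 (F Named [:: v 0; s 0; v 2; v 0]);
      (* 21 *) R [:: Z 0] [::] (F Named [:: v 0; s 0; v 0; v 0]);
      (* 22 *) R [:: G 0 SGCI; G 1 SName]
                 [:: F ConceptEnd [:: s 0; v 1]; F NameEnd [:: s 1; v 2];
                     F Annot [:: v 2; v 3; v 4]; F Conc [:: v 6; s 0; v 4; v 5]]
                 (F Named [:: v 6; s 1; v 3; v 5]);
      (* 23 *) R [:: G 0 SGCI; G 1 SEx]
                 [:: F ConceptEnd [:: s 0; v 1]; F NameEnd [:: s 1; v 2];
                     F Annot [:: v 2; v 3; v 4]; F Conc [:: v 6; s 0; v 4; v 5]]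
                 (F Succ [:: v 6; s 1; v 3; v 5]);
      (* 24 *) R [:: G 0 SRan]
                 [:: F NameEnd [:: s 0; v 1]; F NameEnd [:: v 1; v 2];
                     F Annot [:: v 2; v 3; v 4]; F Role [:: v 6; v 7; v 4; v 5];
                     F SameName [:: v 7; s 0]]
                 (F Named [:: v 6; v 1; v 3; v 5]);
      (* 25 *) R [:: G 0 SRole]
                 [:: F NameEnd [:: s 0; v 1]; F NameEnd [:: v 1; v 2];
                     F Annot [:: v 2; v 3; v 4]; F Role [:: v 6; v 7; v 4; v 5];
                     F SameName [:: v 7; s 0]]
                 (F Role [:: v 6; v 1; v 3; v 5]);
      (* 26 *) R [::] [:: F SameName [:: v 0; v 0]] (F Role [:: v 0; v 0; v 1; v 1]);
      (* 27 *) R [:: G 0 STop] [::] (F Conc [:: v 2; v 0; v 1; v 1]);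
      (* 28 *) R [:: G 0 SName]
                 [:: F Named [:: v 1; v 2; v 3; v 4]; F SameName [:: v 2; s 0]]
                 (F Conc [:: v 1; v 0; v 3; v 4]);
      (* 29 *) R [:: G 0 SAnd]
                 [:: F ConceptEnd [:: s 0; v 1]; F Conc [:: v 2; s 0; v 3; v 4];
                     F Conc [:: v 2; v 1; v 4; v 5]]
                 (F Conc [:: v 2; v 0; v 3; v 5]);
      (* 30 *) R [:: G 0 SEx]
                 [:: F NameEnd [:: s 0; v 1]; F Role [:: v 2; v 3; v 5; v 6];
                     F SameName [:: v 3; s 0]; F Succ [:: v 4; v 2; v 6; v 7];
                     F Conc [:: v 2; v 1; v 7; v 8]]
                 (F Conc [:: v 4; v 0; v 5; v 8]);
      (* 31 *) R [:: Z 0]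
                 [:: F NameEnd [:: s 0; v 1]; F NameEnd [:: v 1; v 2];
                     F Named [:: v 0; v 3; v 2; v 0]; F SameName [:: v 3; v 1]]
                 (F Goal [:: v 0])].

Lemma derivation_rules_wf : all (rule_wf 9 4) derivation_rules.
Proof. by []. Qed.

(** * Parsing by facts *)

Section Facts.
Variable w : seq symbol.

Definition fact (k : kind) (l : seq nat) : Prop := derives derivation_rules w k l.

(** For a concrete rank the folds compute to plain conjunctions, so a rule is applied by giving its
    rank and the values of its variables. *)
Lemma fact_rule i (vals : seq nat) :
    let rl := nth (nth ([::], [::], (Goal, [::])) derivation_rules 0) derivation_rules i in
    i < size derivation_rules -> all (fun p => p <= size w) vals ->
    foldr (fun g Q => letter w (nth 0 vals g.1) = g.2 /\ Q) True rl.1.1 ->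
    foldr (fun a Q => fact a.1 (atom_args (nth 0 vals) a) /\ Q) True rl.1.2 ->
  fact rl.2.1 (atom_args (nth 0 vals) rl.2).
Proof.
move=> rl hi hv hg hb; apply: DerivesRule; first exact: mem_nth.
- move=> x; have [hx|hx] := ltnP x (size vals); last by rewrite nth_default.
  exact: (allP hv) (mem_nth _ hx).
- elim: rl.1.1 hg => //= g l IH [e h] g'; rewrite inE => /orP[/eqP->//|]; exact: IH.
- elim: rl.1.2 hb => //= a l IH [e h] a'; rewrite inE => /orP[/eqP->//|]; exact: IH.
Qed.

Fixpoint at_pos (p : nat) (u : seq symbol) : Prop :=
  if u is a :: u' then letter w p = Some a /\ at_pos p.+1 u' else True.

Lemma at_pos_cat p u u' : at_pos p (u ++ u') <-> at_pos p u /\ at_pos (p + size u) u'.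
Proof.
elim: u p => [|a u IH] p /=; first by rewrite addn0; split=> // -[].
by rewrite IH addSnnS; tauto.
Qed.

Lemma letter_le p a : letter w p = Some a -> p <= size w.
Proof.
by case: p => [|p]; rewrite /letter //= => h; rewrite ltnNge; apply/negP => h';
  move: h; rewrite nth_default // size_map.
Qed.

(** The place after the name becomes the value of a variable when the rules recurse, hence the
    bound. *)
Lemma fact_name_end p s : at_pos p (enc_name s) -> p + size (enc_name s) <= size w ->
  fact NameEnd [:: p; p + size (enc_name s); p; p].
Proof.
rewrite /enc_name; elim: s p => [|b s IH] p /= [h h'] hle.
  have := @fact_rule 0 [:: p] isT; rewrite /= /atom_args /term_val /= addn1; apply=> //.
  by rewrite (letter_le h).
have := IH _ h'; rewrite addSnnS => /(_ hle) hf.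
have := @fact_rule (if b then 1 else 2) [:: p; p + (size (rcons [seq SBit i | i <- s] SEnd)).+1].
by case: b h => h; rewrite /= /atom_args /term_val /=; apply=> //; rewrite (letter_le h) hle.
Qed.

Lemma at_pos_of_cat u a v : w = u ++ a ++ v -> at_pos (size u).+1 a.
Proof.
elim: a u => //= x a IH u e; split; last first.
  by have := IH (rcons u x); rewrite size_rcons cat_rcons; apply.
by rewrite /letter /= e map_cat nth_cat size_map ltnn subnn.
Qed.

Lemma at_pos_drop p u : at_pos p.+1 u -> drop p w = u ++ drop (p + size u) w.
Proof.
elim: u p => [|a u IH] p /=; first by rewrite addn0.
case=> h /IH; rewrite addSnnS => <-; have hp := letter_le h.
by move: h; rewrite /letter /= (drop_nth a) // (nth_map a) // => -[->].
Qed.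

Lemma at_pos_cons_split p a u : at_pos p (a :: u) ->
  exists x v, w = x ++ (a :: u) ++ v /\ p = (size x).+1.
Proof.
case: p => [[]//|p] h; have hp := letter_le h.1.
exists (take p w), (drop (p + size (a :: u)) w); split.
  by rewrite -(at_pos_drop h) cat_take_drop.
by rewrite size_takel // ltnW.
Qed.

(** The codes of names form a prefix code, [SEnd] occurring only at their end. *)
Lemma at_name_inj p s s' :
  at_pos p (enc_name s) -> at_pos p (enc_name s') -> s = s'.
Proof.
elim: s s' p => [|b s IH] [|b' s'] p //= [h h1] [h' h1']; move: h'; rewrite h //=.
by case=> <-; rewrite (IH _ _ h1 h1').
Qed.

Lemma at_concept_inj p C C' :
  at_pos p (enc_concept C) -> at_pos p (enc_concept C') -> C = C'.
Proof.
elim: C C' p => [|A|R C IH|C1 IH1 C2 IH2] [|A'|R' C'|C1' C2'] p //= [h h1] [h' h1'];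
  move: h'; rewrite h //= => _.
- by rewrite (at_name_inj h1 h1').
- move/at_pos_cat: h1 => [hR hC]; move/at_pos_cat: h1' => [hR' hC'].
  have eR := at_name_inj hR hR'; subst R'.
  by rewrite (IH _ _ hC hC').
- move/at_pos_cat: h1 => [hR hC]; move/at_pos_cat: h1' => [hR' hC'].
  have eR := IH1 _ _ hR hR'; subst C1'.
  by rewrite (IH2 _ _ hC hC').
Qed.

Lemma fact_same_name p p' s :
  at_pos p (enc_name s) -> at_pos p' (enc_name s) -> fact SameName [:: p; p'; p; p].
Proof.
rewrite /enc_name; elim: s p p' => [|b s IH] p p' /= [h h1] [h' h1'].
  have := @fact_rule 3 [:: p; p'] isT; rewrite /= /atom_args /term_val /=; apply=> //.
  by rewrite (letter_le h) (letter_le h').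
have := @fact_rule (if b then 4 else 5) [:: p; p'].
have hf := IH _ _ h1 h1'.
by case: b h h' => h h'; rewrite /= /atom_args /term_val /=; apply=> //;
  rewrite (letter_le h) (letter_le h').
Qed.

Lemma fact_concept_end p C : at_pos p (enc_concept C) ->
  p + size (enc_concept C) <= size w ->
  fact ConceptEnd [:: p; p + size (enc_concept C); p; p].
Proof.
elim: C p => [|A|R C IH|C1 IH1 C2 IH2] p /=.
- move=> [h _] hle; have := @fact_rule 6 [:: p] isT.
  rewrite /= /atom_args /term_val /= addn1; apply=> //; by rewrite (letter_le h).
- move=> [h h1] hle; rewrite -addSnnS in hle *.
  have := @fact_rule 7 [:: p; p.+1 + size (enc_name A)] isT.
  rewrite /= /atom_args /term_val /=; apply=> //; first by rewrite (letter_le h) hle.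
  by split=> //; apply: fact_name_end.
- move=> [h /at_pos_cat[h1 h2]]; rewrite -addSnnS size_cat addnA => hle.
  have := @fact_rule 8 [:: p; p.+1 + size (enc_name R);
    p.+1 + size (enc_name R) + size (enc_concept C)] isT.
  rewrite /= /atom_args /term_val /=; apply=> //.
    by rewrite (letter_le h) hle; move: hle; lia.
  by split; [apply: fact_name_end => //; lia|split=> //; apply: IH].
- move=> [h /at_pos_cat[h1 h2]]; rewrite -addSnnS size_cat addnA => hle.
  have := @fact_rule 9 [:: p; p.+1 + size (enc_concept C1);
    p.+1 + size (enc_concept C1) + size (enc_concept C2)] isT.
  rewrite /= /atom_args /term_val /=; apply=> //.
    by rewrite (letter_le h) hle; move: hle; lia.
  by split; [apply: IH1 => //; lia|split=> //; apply: IH2].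
Qed.

End Facts.

(** * Positions in the encoded instance *)

Section Instance.
Variables (T : tbox) (A0 B0 : cname) (m : monomial).
Let w := enc_instance (Instance T A0 B0 m).

(** For a prefix [m1] of [m], the place where the encoding of the rest of [m] begins. *)
Definition mpos (m1 : monomial) : nat :=
  (size (enc_name A0) + size (enc_name B0) + size (enc_monomial m1)).+1.

(* The word read before the product reaches position [p] of [m]; position 0
   stands for [m ++ n], that is for the whole expected annotation. *)
Definition state_at (n : monomial) (p : nat) (mu : monomial) : Prop :=
  (p = 0 /\ mu = m ++ n) \/ (exists m2, m = mu ++ m2 /\ p = mpos mu).

Lemma enc_monomial_cat m1 m2 :
  enc_monomial (m1 ++ m2) = enc_monomial m1 ++ enc_monomial m2.
Proof. by rewrite /enc_monomial map_cat flatten_cat. Qed.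

Lemma mpos_inj m1 m2 m1' m2' :
  m1 ++ m2 = m1' ++ m2' -> mpos m1 = mpos m1' -> m1 = m1'.
Proof.
move=> e; rewrite /mpos => -[/addnI]; elim: m1 m1' e => [|v m1 IH] [|v' m1'] //=.
by case=> -> e; rewrite /= !size_cat => -[/addnI/(IH _ e)->].
Qed.

Lemma state_at_inj n p mu mu' : state_at n p mu -> state_at n p mu' -> mu = mu'.
Proof.
case=> [[-> ->]|[m2 [e ->]]] [[// ->]|[m2' [e' ep]]] //.
by apply: (@mpos_inj mu m2 mu' m2') => //; rewrite -e.
Qed.

Lemma at_monomial m1 m2 : m = m1 ++ m2 ->
  at_pos w (mpos m1) (enc_monomial m2 ++ SSep :: enc_tbox T).
Proof.
move=> e; have := @at_pos_of_cat w (enc_name A0 ++ enc_name B0 ++ enc_monomial m1)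
  (enc_monomial m2 ++ SSep :: enc_tbox T) [::].
rewrite !size_cat addnA; apply.
by rewrite cats0 /w /enc_instance /= e enc_monomial_cat -!catA.
Qed.

Lemma at_lhs : at_pos w 1 (enc_name A0).
Proof. exact: (@at_pos_of_cat w [::]). Qed.

Lemma at_rhs : at_pos w (1 + size (enc_name A0)) (enc_name B0).
Proof. exact: (@at_pos_of_cat w (enc_name A0)). Qed.

Lemma svar_state m1 m2 : m = m1 ++ m2 -> letter w (mpos m1) = Some SVar ->
  exists v m3, m2 = v :: m3 /\ at_pos w (mpos m1).+1 (enc_name v).
Proof.
move/at_monomial; case: m2 => [|v m2] /=; first by case=> ->.
by rewrite -!catA => -[_ /at_pos_cat[h _]] _; exists v, m2.
Qed.

Lemma ssep_state m1 m2 : m = m1 ++ m2 -> letter w (mpos m1) = Some SSep -> m2 = [::].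
Proof. by move/at_monomial; case: m2 => [|v m2] //= [->]. Qed.

Lemma mpos_next m1 v : (mpos m1).+1 + size (enc_name v) = mpos (rcons m1 v).
Proof.
by rewrite /mpos -cats1 enc_monomial_cat size_cat /= size_cat /= addn0; lia.
Qed.

(** These symbols occur in an encoded instance only as first letters of axioms. *)
Definition axiom_head (a : symbol) : bool :=
  match a with SGCI | SRole | SRan => true | _ => false end.

Lemma enc_name_head s : all (predC axiom_head) (enc_name s).
Proof. by rewrite /enc_name all_rcons /=; elim: s. Qed.

Lemma enc_concept_head C : all (predC axiom_head) (enc_concept C).
Proof.
by elim: C => //= *; rewrite ?all_cat ?enc_name_head //; apply/andP.
Qed.

Lemma enc_axiom_head ax : exists h u,
  [/\ enc_axiom ax = h :: u, axiom_head h & all (predC axiom_head) u].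
Proof.
case: ax => [C D|R S|R A]; eexists; eexists; split=> //; rewrite all_cat.
- by rewrite enc_concept_head; case: D => ? /=; apply: enc_name_head.
- by rewrite !enc_name_head.
- by rewrite !enc_name_head.
Qed.

Lemma enc_annotation_head a : all (predC axiom_head) (enc_annotation a).
Proof. by case: a => //= v; apply: enc_name_head. Qed.

Lemma skip_nonhead u B x h z : all (predC axiom_head) u -> axiom_head h ->
  u ++ B = x ++ h :: z -> exists x', B = x' ++ h :: z.
Proof.
move=> hu hh; elim: u x hu => [|c u IH] x /=; first by exists x.
case/andP=> hc /IH{}IH; case: x => [|c' x] /= [e]; last exact: IH.
by rewrite e hh in hc.
Qed.

(** The rules look for axioms anywhere in the word. A head symbol pins the start of an axiom of the
    TBox, and the codes of annotated axioms are uniquely readable from there. *)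
Lemma axiom_at p ax a : at_pos w p (enc_axiom ax ++ enc_annotation a) -> List.In (ax, a) T.
Proof.
have [h [u [eax hh hu]]] := enc_axiom_head ax.
rewrite eax cat_cons => /at_pos_cons_split[x [v [e _]]].
have e' : enc_name A0 ++ enc_name B0 ++ enc_monomial m ++ SSep :: enc_tbox T =
   x ++ h :: (u ++ enc_annotation a) ++ v := e.
have hpre : all (predC axiom_head) (enc_name A0 ++ enc_name B0 ++ enc_monomial m ++ [:: SSep]).
  rewrite !all_cat !enc_name_head /= andbT.
  by elim: (m) => //= y l IH; rewrite all_cat enc_name_head.
(* All that precedes the TBox is free of head symbols, so the occurrence lies in the TBox. *)
have [|x'] := @skip_nonhead _ (enc_tbox T) x h ((u ++ enc_annotation a) ++ v) hpre hh.
  by rewrite -e' -!catA.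
elim: (T) x' => [|[ax' a'] T' IH] x'; first by case: x'.
rewrite /enc_tbox /= -/(enc_tbox T') -!catA.
have [h' [u' [eax' hh' hu']]] := enc_axiom_head ax'.
case: x' => [|c x'] /=.
  have -> : h :: u ++ enc_annotation a ++ v = enc_axiom ax ++ enc_annotation a ++ v by rewrite eax.
  case/enc_axiom_inj=> ->; case: (a') (a) => [s|] [s'|] //= []; last by left.
  by case/enc_name_inj=> ->; left.
rewrite eax' /= => -[_]; rewrite catA => /skip_nonhead[||x'' ex] //.
  by rewrite all_cat hu' enc_annotation_head.
by right; apply: (IH x''); rewrite ex -catA.
Qed.

Lemma at_axiom ax a : List.In (ax, a) T ->
  exists p, at_pos w p (enc_axiom ax ++ enc_annotation a).
Proof.
move=> hin; suff [x [v e]] : exists x v,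
    enc_tbox T = x ++ (enc_axiom ax ++ enc_annotation a) ++ v.
  exists (size (enc_name A0 ++ enc_name B0 ++ enc_monomial m ++ SSep :: x)).+1.
  apply: (@at_pos_of_cat w _ _ v).
  by rewrite /w /enc_instance /= e -!catA.
elim: (T) hin => //= -[ax' a'] T' IH [[-> ->]|/IH[x [v e]]].
  by exists [::], (enc_tbox T').
exists ((enc_axiom ax' ++ enc_annotation a') ++ x), v.
by rewrite /enc_tbox /= -/(enc_tbox T') e -!catA.
Qed.

End Instance.

(** * Soundness of the rules *)

Section Soundness.
Variables (T : tbox) (A0 B0 : cname) (m : monomial).
Let w := enc_instance (Instance T A0 B0 m).
Variables (I : interp) (e0 : dom I) (n0 : monomial).
Hypotheses (IT : is_model I T) (He0 : conc A0 e0 (mon I n0)).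

Local Notation at_pos := (at_pos w).
Local Notation state_at := (state_at A0 B0 m n0).
Local Notation mpos := (mpos A0 B0).

(** The action of an annotation on prefixes, under a condition [ctx] on the prefix read so far. It
    holds vacuously when [i] is no state, which makes rules 17, 26 and 27 sound at every
    position. *)
Definition carried (i j : nat) (ctx Q : monomial -> Prop) : Prop :=
  forall mu, state_at i mu -> ctx mu ->
    exists nu W, [/\ state_at j nu, Q W & eq_absorb (mu ++ W) nu].

(* The elements of [I] that the node [c] stands for: [e0] for the root, and
   any successor along the role spelt at [c] otherwise, provided its
   incoming annotation is already absorbed. *)
Definition denotes (c : nat) (e : dom I) (mu : monomial) : Prop :=
  (c = 0 /\ e = e0) \/
  (exists R d v, [/\ at_pos c (enc_name R), role R d e (mon I v) & {subset v <= mu}]).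

(** The induction invariant: what a fact asserts of a fixed but arbitrary model. A [Role] fact
    concerns every edge, whose own annotation [v] stays to the right of the annotation of the
    inclusion. *)
Definition meaning (k : kind) (l : seq nat) : Prop :=
  if l is [:: p; q; i; j] then
    match k with
    | NameEnd => exists s, at_pos p (enc_name s) /\ q = p + size (enc_name s)
    | SameName => exists s, at_pos p (enc_name s) /\ at_pos q (enc_name s)
    | ConceptEnd =>
        exists C, at_pos p (enc_concept C) /\ q = p + size (enc_concept C)
    | State => exists m1 m2, m = m1 ++ m2 /\ p = mpos m1
    | Before => exists s mu, [/\ at_pos p.+1 (enc_name s), state_at q mu & s \in mu]
    | Skip => exists m1 m2 m3, [/\ m = m1 ++ m2 ++ m3, p = mpos m1,
        q = mpos (m1 ++ m2) & {subset m2 <= m1}]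
    | Annot => exists a, at_pos p (enc_annotation a) /\
        carried q i xpredT (eq (mon_of_annotation a))
    | Named => exists A, at_pos q (enc_name A) /\
        forall e, carried i j (denotes p e) (fun W => conc A e (mon I W))
    | Conc => exists C, at_pos q (enc_concept C) /\
        forall e, carried i j (denotes p e) (fun W => cext C e (mon I W))
    | Role => exists R S, [/\ at_pos p (enc_name R), at_pos q (enc_name S) &
        carried i j xpredT (fun W => forall d e v,
          role R d e (mon I v) -> role S d e (mon I (W ++ v)))]
    | Succ => exists R, at_pos q (enc_name R) /\
        forall e, carried i j (denotes p e) (fun W => rhs_ext (REx R) e (mon I W))
    | Goal => exists W, conc B0 e0 (mon I W) /\ eq_absorb W (m ++ n0)
    end
  else False.

Lemma carried_refl i ctx (Q : monomial -> Prop) : Q [::] -> carried i i ctx Q.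
Proof. by move=> h mu hmu _; exists mu, [::]; rewrite cats0. Qed.

Lemma carried_comp i l j (ctx Q1 Q2 Q : monomial -> Prop) :
    (forall mu W nu, ctx mu -> eq_absorb (mu ++ W) nu -> ctx nu) ->
    carried i l ctx Q1 -> carried l j ctx Q2 ->
    (forall W1 W2, Q1 W1 -> Q2 W2 -> Q (W1 ++ W2)) -> carried i j ctx Q.
Proof.
move=> hc h1 h2 h mu /h1 + cmu => /(_ cmu)[nu [W1 [hnu q1 e1]]].
have [nu' [W2 [hnu' q2 e2]]] := h2 nu hnu (hc _ _ _ cmu e1).
exists nu', (W1 ++ W2); split=> //; first exact: h.
by rewrite catA; rewrite /eq_absorb -e2; apply: eq_absorb_cat.
Qed.

Lemma carried_weaken i j (ctx ctx' Q : monomial -> Prop) :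
  (forall mu, ctx mu -> ctx' mu) -> carried i j ctx' Q -> carried i j ctx Q.
Proof. by move=> h hc mu hmu /h; apply: hc. Qed.

Lemma eq_absorb_sub mu W nu : eq_absorb (mu ++ W) nu -> {subset mu <= nu}.
Proof. by move=> /eq_absorb_mem e v hv; rewrite -e mem_cat hv. Qed.

Lemma denotes_mono c e mu W nu :
  denotes c e mu -> eq_absorb (mu ++ W) nu -> denotes c e nu.
Proof.
case=> [?|[R [d [v [h1 h2 h3]]]]] hs; first by left.
by right; exists R, d, v; split=> // x /h3; apply: eq_absorb_sub hs _.
Qed.

(** Position 0 has no letter, so no role is spelt there. *)
Lemma denotes0 e mu : denotes 0 e mu -> e = e0.
Proof. by case=> [[]//|[R [d [v [h _ _]]]]]; case: R h => [|b R] []. Qed.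

Lemma monE u v : eq_absorb u v -> mon I u = mon I v.
Proof. by move/monP. Qed.

Lemma axiom_sat ax a p : at_pos p (enc_axiom ax) ->
  at_pos (p + size (enc_axiom ax)) (enc_annotation a) ->
  satisfies I ax (mon_of_annotation a).
Proof.
by move=> h1 h2; apply: IT; apply: (@axiom_at T A0 B0 m p); apply/at_pos_cat.
Qed.

Definition rule_sound (rl : rule symbol kind) : Prop := forall rho : nat -> nat,
  (forall x, rho x <= size w) ->
  foldr (fun g Q => letter w (rho g.1) = g.2 /\ Q) True rl.1.1 ->
  foldr (fun a Q => meaning a.1 (atom_args rho a) /\ Q) True rl.1.2 ->
  meaning rl.2.1 (atom_args rho rl.2).

Lemma letter_None p : letter w p = None -> p <= size w -> p = 0.
Proof.
case: p => // p; rewrite /letter /= => h hp; move: h.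
by rewrite (nth_map SEnd).
Qed.

(** The fold computes to one conjunct for each rule, treated in the order of the ranks. *)
Lemma rules_sound : foldr (fun rl Q => rule_sound rl /\ Q) True derivation_rules.
Proof.
rewrite /=; repeat match goal with |- _ /\ _ => split end; last by [].
all: move=> rho hle; rewrite /= /atom_args /term_val /=.
- move=> [h _] _; exists [::]; rewrite /= addn1; done.
- move=> [h _] [[s [h1 ->]] _]; exists (true :: s); rewrite /= addSnnS; done.
- move=> [h _] [[s [h1 ->]] _]; exists (false :: s); rewrite /= addSnnS; done.
- by move=> [h [h' _]] _; exists [::].
- by move=> [h [h' _]] [[s [h1 h2]] _]; exists (true :: s).
- by move=> [h [h' _]] [[s [h1 h2]] _]; exists (false :: s).
- by move=> [h _] _; exists CTop; rewrite /= addn1.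
- by move=> [h _] [[s [h1 ->]] _]; exists (CName s); rewrite /= addSnnS.
- move=> [h _] [[s [h1 ->]] [[C [h2 ->]] _]]; exists (CEx s C); rewrite /= size_cat.
  by rewrite at_pos_cat; split; [|lia].
- move=> [h _] [[C [h1 ->]] [[D [h2 ->]] _]]; exists (CAnd C D); rewrite /= size_cat.
  by rewrite at_pos_cat; split; [|lia].
- move=> [/letter_None/(_ (hle 0))-> _] [[s [h1 ->]] [[s' [h2 ->]] _]].
  rewrite (at_name_inj h1 (at_lhs T A0 B0 m)) in h2 *.
  rewrite (at_name_inj h2 (at_rhs T A0 B0 m)).
  by exists [::], m; rewrite /mpos /=; split=> //; lia.
- move=> [h _] [[m1 [m2 [e ep]]] [[s [h1 ->]] _]]; rewrite ep in h h1 *.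
  have [v [m3 [e2 h3]]] := svar_state e h.
  rewrite (at_name_inj h1 h3) mpos_next; exists (rcons m1 v), m3.
  by rewrite e e2 cat_rcons.
- move=> [h _] [[m1 [m2 [e ep]]] [[s [h1 ->]] _]]; rewrite ep in h h1 *.
  have [v [m3 [e2 h3]]] := svar_state e h.
  rewrite (at_name_inj h1 h3) mpos_next; exists v, (rcons m1 v); split=> //.
    by right; exists m3; rewrite e e2 cat_rcons.
  by rewrite mem_rcons inE eqxx.
- move=> [h _] [[s [mu [hs [[e _]|[m2 [e ep]]] hm]]] [[s' [h1 ->]] _]].
    by rewrite e in h.
  rewrite ep in h h1 *; have [v [m3 [e2 h3]]] := svar_state e h.
  rewrite (at_name_inj h1 h3) mpos_next; exists s, (rcons mu v); split=> //.
    by right; exists m3; rewrite e e2 cat_rcons.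
  by rewrite mem_rcons inE hm orbT.
- move=> [/letter_None/(_ (hle 0))-> [h _]] [[s [mu [hs [[e _]|[m2 [e ep]]] hm]]] _].
    by rewrite e in h.
  rewrite ep in h; have e2 := ssep_state e h; exists s, (m ++ n0); split=> //; first by left.
  by rewrite e e2 cats0 mem_cat hm.
- by move=> _ [[m1 [m2 [e ->]]] _]; exists m1, [::], m2; rewrite cats0.
- move=> [h _] [[m1 [m2 [m3 [e e1 e2 hsub]]]] [[s [mu [hs hmu hin]]] +]].
  move=> [[s' [h1 h2]] [[s'' [h3 ->]] _]].
  rewrite e2 in h h2 h3 hmu *.
  have hmu' : state_at (mpos (m1 ++ m2)) (m1 ++ m2) by right; exists m3; rewrite -catA.
  have [v [m4 [e4 h4]]] : exists v m4,
      m3 = v :: m4 /\ at_pos (mpos (m1 ++ m2)).+1 (enc_name v).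
    by apply: svar_state h; rewrite -catA.
  exists m1, (rcons m2 v), m4; rewrite (at_name_inj h3 h4) mpos_next; split=> //.
    by rewrite e e4 cat_rcons.
    by rewrite rcons_cat.
  (* The letter just read occurs in [m1 ++ m2], whose letters are all in [m1], so it is absorbed
     too. *)
  have ev : v = s by rewrite (at_name_inj h4 h2) (at_name_inj hs h1).
  rewrite (state_at_inj hmu hmu') -ev in hin.
  move=> x; rewrite mem_rcons inE => /orP[/eqP->|/hsub//].
  by move: hin; rewrite mem_cat => /orP[//|/hsub].
- by move=> [h _] _; exists None; split=> //; apply: carried_refl.
- move=> [h _] [[s [mu [hs hmu hin]]] [[s' [h1 h2]] _]]; exists (Some s); split.
    by split=> //; rewrite (at_name_inj hs h1).
  move=> mu' hmu' _; exists mu', [:: s]; split=> //; apply/eq_absorb_catl => x.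
  by rewrite inE (state_at_inj hmu' hmu) => /eqP->.
(* As [m1] absorbs [m2], reading [v] after [m1] leads to the prefix [m1 m2 v]. *)
- move=> [h [h' _]] [[m1 [m2 [m3 [e e1 e2 hsub]]]] [[s' [h1 h2]] [[s'' [h3 ->]] _]]].
  rewrite e2 in h' h1 h3 *.
  have [v [m4 [e4 h4]]] : exists v m4,
      m3 = v :: m4 /\ at_pos (mpos (m1 ++ m2)).+1 (enc_name v).
    by apply: svar_state h'; rewrite -catA.
  exists (Some v); split; first by split=> //; rewrite (at_name_inj h4 h1).
  move=> mu hmu _; exists (rcons (m1 ++ m2) v), [:: v]; split=> //.
    right; exists m4; rewrite e e4 -cats1 -!catA; split=> //.
    by rewrite (at_name_inj h3 h4) mpos_next catA cats1.
  have hmu' : state_at (rho 2) m1 by right; exists (m2 ++ m3).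
  rewrite (state_at_inj hmu hmu') -cats1; apply: eq_absorb_cat => //.
  by apply/esym/eq_absorb_catl.
(* The rest of [m] is absorbed, so reading [n0], the annotation of the root, completes [m ++ n0]. *)
- move=> [/letter_None/(_ (hle 0))-> [h _]] [[m1 [m2 [m3 [e e1 e2 hsub]]]] _].
  rewrite e2 in h; have e3 : m3 = [::] by apply: ssep_state h; rewrite -catA.
  exists A0; split; first exact: at_lhs.
  move=> e' mu hmu /denotes0->; exists (m ++ n0), n0; split=> //; first by left.
  have hmu' : state_at (rho 2) m1 by right; exists (m2 ++ m3); rewrite e e1.
  rewrite (state_at_inj hmu hmu') e e3 cats0; apply: eq_absorb_cat => //.
  by apply/esym/eq_absorb_catl.
- move=> [/letter_None/(_ (hle 0))-> _] _; exists A0; split; first exact: at_lhs.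
  move=> e' mu hmu /denotes0->; exists mu, n0; split=> //.
  have hmu' : state_at 0 (m ++ n0) by left.
  by apply/eq_absorb_catl => x hx; rewrite (state_at_inj hmu hmu') mem_cat hx orbT.
- move=> [h [h' _]] [[C [h1 e1]] [[A [h2 e2]] [[a [h3 ca]] [[C' [h4 cc]] _]]]].
  rewrite -(at_concept_inj h1 h4) in cc.
  have hs : satisfies I (GCI C (RName A)) (mon_of_annotation a).
    apply: (@axiom_sat _ _ (rho 0)); rewrite /= ?at_pos_cat /= -?e1 //.
    by rewrite size_cat addnS -addSn addnA -e1 /= addnS -addSn -e2.
  exists A; split=> // e; apply: carried_comp (cc e) _; first exact: denotes_mono.
    exact: carried_weaken ca.
  by move=> W1 W2 <- /hs.
- move=> [h [h' _]] [[C [h1 e1]] [[R [h2 e2]] [[a [h3 ca]] [[C' [h4 cc]] _]]]].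
  rewrite -(at_concept_inj h1 h4) in cc.
  have hs : satisfies I (GCI C (REx R)) (mon_of_annotation a).
    apply: (@axiom_sat _ _ (rho 0)); rewrite /= ?at_pos_cat /= -?e1 //.
    by rewrite size_cat addnS -addSn addnA -e1 /= addnS -addSn -e2.
  exists R; split=> // e; apply: carried_comp (cc e) _; first exact: denotes_mono.
    exact: carried_weaken ca.
  by move=> W1 W2 <- /hs.
- move=> [h _] [[S [h1 e1]] [[A [h2 e2]] [[a [h3 ca]] +]]].
  move=> [[R [S' [hR hS cr]]] [[S'' [h4 h5]] _]].
  have eS : S' = S by rewrite (at_name_inj hS h4) (at_name_inj h5 h1).
  rewrite {}eS in cr; rewrite e1 in h2.
  have hs : satisfies I (RanRestr S A) (mon_of_annotation a).
    apply: (@axiom_sat _ _ (rho 0)); rewrite /= ?at_pos_cat /= //.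
    by rewrite size_cat addnS -addSn addnA -e1 -e2.
  exists A; rewrite e1; split=> // e mu hmu hd.
  have {}cr : carried (rho 3) (rho 5) xpredT (fun W => forall d e v,
      role R d e (mon I v) -> conc A e (mon I (W ++ v))).
    apply: carried_comp ca cr _ => // W1 W2 <- hW d e' v /hW hr.
    by rewrite -catA; apply: hs; exists d, (W2 ++ v).
  have [nu [W [hnu qW eW]]] := cr mu hmu isT.
  case: hd => [[e6 _]|[R' [d [v [hR' hr sv]]]]].
    by rewrite e6 in hR; case: (R) hR => [|b R0] [].
  (* The range restriction brings in the annotation [v] of the edge, which the prefix at a successor
     already absorbs. *)
  exists nu, (W ++ v); split=> //; first by apply: qW; rewrite (at_name_inj hR hR'); exact: hr.
  rewrite /eq_absorb -eW catA; apply/eq_absorb_catl => x /sv hx.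
  by rewrite mem_cat hx.
- move=> [h _] [[S [h1 e1]] [[S2 [h2 e2]] [[a [h3 ca]] +]]].
  move=> [[R [S' [hR hS cr]]] [[S'' [h4 h5]] _]].
  have eS : S' = S by rewrite (at_name_inj hS h4) (at_name_inj h5 h1).
  rewrite {}eS in cr; rewrite e1 in h2 *.
  have hs : satisfies I (RoleIncl S S2) (mon_of_annotation a).
    apply: (@axiom_sat _ _ (rho 0)); rewrite /= ?at_pos_cat /= //.
    by rewrite size_cat addnS -addSn addnA -e1 -e2.
  exists R, S2; split=> //; apply: carried_comp ca cr _ => //.
  by move=> W1 W2 <- hW d e v /hW/hs; rewrite catA.
- by move=> _ [[R [h _]] _]; exists R, R; split=> //; apply: carried_refl.
- by move=> [h _] _; exists CTop; split=> // e; apply: carried_refl.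
- move=> [h _] [[A [h1 cA]] [[A' [h2 h3]] _]]; exists (CName A); split=> //=.
  by rewrite (at_name_inj h1 h2).
- move=> [h _] [[C [h1 e1]] [[C' [h2 c1]] [[D [h3 c2]] _]]].
  rewrite -(at_concept_inj h1 h2) in c1; exists (CAnd C D); split=> /=.
    by rewrite at_pos_cat -e1.
  move=> e; apply: carried_comp (c1 e) (c2 e) _; first exact: denotes_mono.
  by move=> W1 W2 q1 q2; exists W1, W2.
- move=> [h _] [[S [h1 e1]] [[R [S' [h2 h3 cr]]]  [[S'' [h4 h5]] +]]].
  move=> [[R' [h6 cs]] [[D [h7 cd]] _]].
  have eS : S' = S by rewrite (at_name_inj h3 h4) (at_name_inj h5 h1).
  rewrite {}eS in cr; rewrite -(at_name_inj h2 h6) in cs.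
  exists (CEx S D); split=> /=; first by rewrite at_pos_cat -e1.
  move=> e mu hmu hd.
  have [nu1 [u [hnu1 qu eu]]] := cr mu hmu isT.
  have [nu2 [v [hnu2 [e' [v' [rv ev]]] ev']]] := cs e nu1 hnu1 (denotes_mono hd eu).
  rewrite -ev in rv.
  (* The edge annotation has just been read into [nu2], so the node spelt by its role denotes [e']
     from there on. *)
  have [|nu3 [W [hnu3 qW eW]]] := cd e' nu2 hnu2.
    right; exists R, e, v; split=> // x hx.
    by rewrite -(eq_absorb_mem ev') mem_cat hx orbT.
  exists nu3, (u ++ (v ++ W)); split=> //.
    by exists e', (u ++ v), W; rewrite -catA; split=> //; apply: qu.
  rewrite /eq_absorb -eW 2!catA; apply: eq_absorb_cat => //.
  by rewrite /eq_absorb -ev'; apply: eq_absorb_cat.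
- move=> [/letter_None/(_ (hle 0))-> _] [[s [h1 e1]] [[s' [h2 e2]] +]].
  move=> [[A [h3 cn]] [[s'' [h4 h5]] _]].
  have es : s = A0 := at_name_inj h1 (at_lhs T A0 B0 m); rewrite {}es in e1.
  rewrite e1 in h2 e2 h5; have es := at_rhs T A0 B0 m.
  rewrite (at_name_inj h2 es) in e2; rewrite (at_name_inj h3 h4) (at_name_inj h5 es) in cn.
  (* The derivation starts from the empty prefix, at the place where [m] begins, and ends in state
     0. *)
  have [||nu [W [[[_ ->]|[m2 [_ //]]] hW eW]]] := cn e0 [::]; last by exists W.
    by right; exists m; rewrite e2 /mpos /=; split=> //; lia.
  by left.
Qed.

Lemma fact_meaning k l : fact w k l -> meaning k l.
Proof.
elim=> {k l} rl rho hrl hrho hg _ hb.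
have : rule_sound rl.
  elim: derivation_rules hrl rules_sound {hg hb} => //= rl' rls IH.
  by rewrite inE => /orP[/eqP->|/IH h] [].
apply=> //.
  elim: rl.1.1 hg => //= g gs IH hgs; split; first by apply: hgs; rewrite inE eqxx.
  by apply: IH => g1 hg1; apply: hgs; rewrite inE hg1 orbT.
elim: rl.1.2 hb => //= a l IH hl; split; first by apply: hl; rewrite inE eqxx.
by apply: IH => a1 ha1; apply: hl; rewrite inE ha1 orbT.
Qed.

End Soundness.

(** The root element and its annotation [n] are parameters of the invariant, so one derivation
    serves all of them. *)
Theorem fact_entails T A0 B0 m :
  fact (enc_instance (Instance T A0 B0 m)) Goal (nseq 4 0) ->
  entails T (GCI (CName A0) (RName B0)) m.
Proof.
move=> hf I IT n d hA; have [W [hW eW]] := fact_meaning IT hA hf.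
by rewrite /= -(monE I eW).
Qed.

(** * Completeness of the rules *)

Section Completeness.
Variables (T : tbox) (A0 B0 : cname) (m : monomial) (x : pvar).
Hypothesis xm : x \notin m.
Hypothesis xT : forall ax v, List.In (ax, Some v) T -> v != x.
Let w := enc_instance (Instance T A0 B0 m).

Local Notation at_pos := (at_pos w).
Local Notation fact := (fact w).
Local Notation state_at := (state_at A0 B0 m [:: x]).
Local Notation mpos := (mpos A0 B0).

(** * Annotated derivations and the canonical model *)

Inductive subrole : rname -> rname -> monomial -> Prop :=
| SubroleRefl R : subrole R R [::]
| SubroleStep R S S' a u : List.In (RoleIncl S S', a) T -> subrole R S u ->
    subrole R S' (mon_of_annotation a ++ u).

(* An element of the canonical model is the list of the (role, annotation)
   pairs through which it is reached from the root, the last one first. *)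
Definition node : Type := seq (rname * monomial).

(** The root carries [A0] with the fresh letter [x]. That an edge is present is checked in [DEx],
    where a successor is used, so [DRan] may speak of any node. *)
Inductive derived : node -> concept -> monomial -> Prop :=
| DTop e : derived e CTop [::]
| DRoot : derived [::] (CName A0) [:: x]
| DAnd e C D u v : derived e C u -> derived e D v -> derived e (CAnd C D) (u ++ v)
| DGCI e C A a u : List.In (GCI C (RName A), a) T -> derived e C u ->
    derived e (CName A) (mon_of_annotation a ++ u)
| DEx e C R a u S v D u' : List.In (GCI C (REx R), a) T -> derived e C u ->
    subrole R S v -> derived ((R, mon_of_annotation a ++ u) :: e) D u' ->
    derived e (CEx S D) (v ++ (mon_of_annotation a ++ u) ++ u')
| DRan e R v S u A a : List.In (RanRestr S A, a) T -> subrole R S u ->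
    derived ((R, v) :: e) (CName A) (mon_of_annotation a ++ u ++ v).

Definition succ_derived (e : node) (R : rname) (u : monomial) : Prop :=
  exists C a v, [/\ List.In (GCI C (REx R), a) T, derived e C v
    & u = mon_of_annotation a ++ v].

(** Annotations are interpreted by their normal forms. An edge carries the annotation with which its
    existence was derived, preceded by that of the role inclusions. *)
Definition canonical : interp.
Proof.
refine (@Interp node monomial (inhabits [::])
  (fun A e a => exists2 u, derived e (CName A) u & a = leftmost u)
  (fun S e e' a => exists R u v, [/\ e' = (R, u) :: e, succ_derived e R u,
     subrole R S v & a = leftmost (v ++ u)])
  leftmost _).
by [].
Defined.

Lemma leftmost_congr u u' v v' : leftmost u = leftmost u' -> leftmost v = leftmost v' ->
  leftmost (u ++ v) = leftmost (u' ++ v').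
Proof. exact: eq_absorb_cat. Qed.

Lemma cext_derived C (e : node) (a : monomial) : @cext canonical C e a ->
  exists2 u, derived e C u & a = leftmost u.
Proof.
elim: C e a => [|A|S C IH|C1 IH1 C2 IH2] e a //=.
- by move=> ->; exists [::] => //; apply: DTop.
- case=> e' [u [v [[R [u1 [v1 [-> [D [b [u2 [hin hD ->]]]] hs hu]]]] /IH[u' hC hv] ->]]].
  exists (v1 ++ (mon_of_annotation b ++ u2) ++ u'); first exact: DEx hin hD hs hC.
  by rewrite catA; apply: leftmost_congr.
- case=> u [v [/IH1[u1 h1 e1] /IH2[u2 h2 e2] ->]].
  by exists (u1 ++ u2); [apply: DAnd|exact: (leftmost_congr e1 e2)].
Qed.

Lemma canonical_model : is_model canonical T.
Proof.
case=> [C [A|R]|S S'|S A] a hin /=.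
- move=> n e /cext_derived[u hu en]; exists (mon_of_annotation a ++ u).
    exact: DGCI hin hu.
  exact: leftmost_congr.
- move=> n e /cext_derived[u hu en].
  exists ((R, mon_of_annotation a ++ u) :: e), (mon_of_annotation a ++ u); split.
    exists R, (mon_of_annotation a ++ u), [::]; split=> //; last exact: SubroleRefl.
    by exists C, a, u.
  exact: leftmost_congr.
- move=> n e e' [R [u [v [-> hs hr en]]]].
  exists R, u, (mon_of_annotation a ++ v); split=> //; first exact: SubroleStep hin hr.
  by rewrite -catA; apply: leftmost_congr.
- move=> n e [e' [n' [[R [u [v [-> hs hr en']]]] en]]].
  exists (mon_of_annotation a ++ v ++ u); first exact: DRan hin hr.
  exact: (leftmost_congr (erefl _) (etrans en en')).
Qed.

Lemma entails_derived : entails T (GCI (CName A0) (RName B0)) m ->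
  exists2 W, derived [::] (CName B0) W & eq_absorb W (m ++ [:: x]).
Proof.
move=> /(_ canonical canonical_model [:: x] [::])[]; last by move=> W h e; exists W.
by exists [:: x] => //; apply: DRoot.
Qed.

(** * Prefixes of the expected annotation *)

Definition reaches (mu : monomial) : Prop :=
  exists j nu, state_at j nu /\ eq_absorb mu nu.

Lemma reaches_prefix mu u : reaches (mu ++ u) -> reaches mu.
Proof.
case=> j [nu [hnu e]]; have [b hb] := eq_absorb_prefix e.
case: hnu => [[_ enu]|[m2 [em _]]]; last first.
  exists (mpos (take b nu)), (take b nu); split=> //; right.
  by exists (drop b nu ++ m2); rewrite catA cat_take_drop.
(* A prefix of [m ++ [:: x]] is a prefix of [m] or the whole word, and both are states. *)
have [hbm|hbm] := leqP b (size m); last first.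
  exists 0, nu; split; first by left.
  by rewrite /eq_absorb hb take_oversize // enu size_cat addn1.
rewrite enu takel_cat // in hb.
exists (mpos (take b m)), (take b m); split=> //; right.
by exists (drop b m); rewrite cat_take_drop.
Qed.

Lemma reaches_eq mu mu' u : eq_absorb mu mu' -> reaches (mu ++ u) -> reaches (mu' ++ u).
Proof.
move=> e [j [nu [hnu enu]]]; exists j, nu; split=> //.
by rewrite /eq_absorb -enu; apply: eq_absorb_cat.
Qed.

Lemma at_le p a u : at_pos p (a :: u) -> p <= size w.
Proof. by case=> /letter_le. Qed.

Lemma name_le p s : at_pos p (enc_name s) -> p <= size w.
Proof. by case: s => [|b s] /at_le. Qed.

Lemma state_le j nu : state_at j nu -> j <= size w.
Proof.
case=> [[->]//|[m2 [e ->]]]; have := at_monomial T A0 B0 e.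
by case: m2 {e} => [|v m2] /at_le.
Qed.

Lemma state_letter m1 v m2 : m = m1 ++ v :: m2 ->
  letter w (mpos m1) = Some SVar /\ at_pos (mpos m1).+1 (enc_name v).
Proof.
by move/(at_monomial T A0 B0) => /= [h]; rewrite -!catA => /at_pos_cat[].
Qed.

Lemma mpos_le m1 m2 : m = m1 ++ m2 -> mpos m1 <= size w.
Proof. by move=> e; apply: (@state_le _ m1); right; exists m2. Qed.

(** * Facts about the prefixes of the monomial *)

Lemma fact_state m1 m2 : m = m1 ++ m2 ->
  fact State [:: mpos m1; mpos m1; mpos m1; mpos m1].
Proof.
elim/last_ind: m1 m2 => [|m1 v IH] m2 e.
  have h1 := at_lhs T A0 B0 m; have h2 := at_rhs T A0 B0 m.
  have hle : mpos [::] <= size w by apply: (@state_le _ [::]); right; exists m.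
  have hm : mpos [::] = 1 + size (enc_name A0) + size (enc_name B0) by rewrite /mpos /=; lia.
  have := @fact_rule w 10 [:: 0; 1 + size (enc_name A0); mpos [::]] isT.
  rewrite /= /atom_args /term_val /=; apply=> //.
    by rewrite hle (name_le h2).
  split; first by apply: fact_name_end => //; apply: name_le h2.
  by split=> //; rewrite hm; apply: fact_name_end => //; rewrite -hm.
have hle := mpos_le e; rewrite cat_rcons in e; have [h h1] := state_letter e.
have := @fact_rule w 11 [:: mpos m1; mpos (rcons m1 v)] isT.
rewrite /= /atom_args /term_val /=; apply=> //; first by rewrite hle (letter_le h).
split; first exact: IH e; split=> //; rewrite -mpos_next; apply: fact_name_end => //.
by rewrite mpos_next.
Qed.

Lemma fact_before_step m1 v m2 p : m = m1 ++ v :: m2 -> p <= size w ->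
  fact Before [:: p; mpos m1; p; p] -> fact Before [:: p; mpos (rcons m1 v); p; p].
Proof.
move=> e hp hb; have [h h1] := state_letter e.
have hle : mpos (rcons m1 v) <= size w by apply: (@mpos_le _ m2); rewrite cat_rcons.
have := @fact_rule w 13 [:: p; mpos m1; mpos (rcons m1 v)] isT.
rewrite /= /atom_args /term_val /=; apply=> //; first by rewrite hp hle (letter_le h).
by split=> //; split=> //; rewrite -mpos_next; apply: fact_name_end; rewrite ?mpos_next.
Qed.

Lemma fact_before_var m1 v m2 : m = m1 ++ m2 -> v \in m1 ->
  exists p, [/\ p <= size w, letter w p = Some SVar, at_pos p.+1 (enc_name v)
    & fact Before [:: p; mpos m1; p; p]].
Proof.
elim/last_ind: m1 m2 => [|m1 u IH] m2 //; rewrite cat_rcons => e.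
have [h h1] := state_letter e.
have hle : mpos (rcons m1 u) <= size w by apply: (@mpos_le _ m2); rewrite cat_rcons.
rewrite mem_rcons inE => /orP[/eqP->|/(IH _ e)[p [hp hl hv hf]]]; last first.
  by exists p; split=> //; apply: fact_before_step e _ _.
exists (mpos m1); split=> //; first exact: letter_le h.
have := @fact_rule w 12 [:: mpos m1; mpos (rcons m1 u)] isT.
rewrite /= /atom_args /term_val /=; apply=> //; first by rewrite hle (letter_le h).
split; first exact: fact_state e.
by split=> //; rewrite -mpos_next; apply: fact_name_end; rewrite ?mpos_next.
Qed.

Lemma ssep_letter : letter w (mpos m) = Some SSep.
Proof. by have [] := at_monomial T A0 B0 (esym (cats0 m)). Qed.

(** The letter [x] of state 0 is excluded, since the facts point to occurrences within [m]. *)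
Lemma fact_before i mu v : state_at i mu -> v \in mu -> v != x ->
  exists p, [/\ p <= size w, at_pos p.+1 (enc_name v) & fact Before [:: p; i; p; p]].
Proof.
case=> [[-> ->]|[m2 [e ->]] hv _]; last first.
  by have [p [h1 _ h2 h3]] := fact_before_var e hv; exists p.
rewrite mem_cat mem_seq1 => /orP[hv _|->//].
have [p [h1 hl h2 h3]] := fact_before_var (esym (cats0 m)) hv; exists p; split=> //.
have := @fact_rule w 14 [:: 0; p; mpos m] isT.
rewrite /= /atom_args /term_val /=; apply=> //.
  by rewrite h1 (letter_le ssep_letter).
by rewrite ssep_letter.
Qed.

Lemma fact_skip m1 m2 m3 : m = m1 ++ m2 ++ m3 -> {subset m2 <= m1} ->
  fact Skip [:: mpos m1; mpos (m1 ++ m2); mpos m1; mpos m1].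
Proof.
elim/last_ind: m2 m3 => [|m2 v IH] m3 e hs.
  rewrite cats0; have := @fact_rule w 15 [:: mpos m1] isT.
  rewrite /= /atom_args /term_val /=; apply=> //; first by rewrite (mpos_le e).
  by split=> //; apply: fact_state e.
have hle : mpos (m1 ++ rcons m2 v) <= size w by apply: (@mpos_le _ m3); rewrite -catA.
have e1 : m = (m1 ++ m2) ++ v :: m3 by rewrite -catA -cat_rcons.
have [h h1] := state_letter e1.
have hv : v \in m1 ++ m2 by rewrite mem_cat hs // mem_rcons inE eqxx.
have [p [hp hl h2 h3]] := fact_before_var e1 hv.
rewrite -rcons_cat in hle *.
have := @fact_rule w 16 [:: mpos m1; mpos (m1 ++ m2); p; mpos (rcons (m1 ++ m2) v)] isT.
rewrite /= /atom_args /term_val /=; apply=> //.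
  by rewrite (mpos_le e) (letter_le h) hp hle.
split; first by apply: (IH (v :: m3)); rewrite -?cat_rcons // => y hy; apply: hs;
  rewrite mem_rcons inE hy orbT.
split=> //; split; first exact: fact_same_name h2 h1.
by split=> //; rewrite -mpos_next; apply: fact_name_end; rewrite ?mpos_next.
Qed.

(** After cancelling the normal form of [mu], the first letter of [nu] that is new to [mu] must be
    [v]. *)
Lemma new_letter (mu nu : monomial) (v : pvar) : v \notin mu ->
  eq_absorb (mu ++ [:: v]) (mu ++ nu) ->
  exists n1 n2, nu = n1 ++ v :: n2 /\ {subset n1 <= mu}.
Proof.
move=> hv; elim: nu => [|y nu IH] e.
  by move/eq_absorb_mem/(_ v): e; rewrite cats0 mem_cat inE eqxx orbT (negbTE hv).
have [hy|hy] := boolP (y \in mu).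
  have [|n1 [n2 [-> hs]]] := IH.
    rewrite /eq_absorb e -[y :: nu]cat1s catA; apply: eq_absorb_cat => //.
    by apply/eq_absorb_catl => z; rewrite inE => /eqP->.
  by exists (y :: n1), n2; split=> // z; rewrite inE => /orP[/eqP->|/hs].
exists [::], nu; split=> //; congr (_ :: _).
move: e; rewrite /eq_absorb -[y :: nu]cat1s catA !leftmost_cat /= hv hy -!catA.
by move/(congr1 (drop (size (leftmost mu)))); rewrite !drop_size_cat // => -[->].
Qed.

Lemma cat_eq_cat (V : Type) (s1 s2 t1 t2 : seq V) : s1 ++ s2 = t1 ++ t2 ->
  (exists u, s1 = t1 ++ u /\ t2 = u ++ s2) \/ (exists u, t1 = s1 ++ u).
Proof.
elim: s1 t1 => [|a s1 IH] [|b t1] /=.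
- by left; exists [::].
- by right; exists (b :: t1).
- by move=> e; left; exists (a :: s1).
- by case=> -> /IH[[u [-> ->]]|[u ->]]; [left|right]; exists u.
Qed.

Lemma cat_cons_last (s n1 n2 : monomial) v : s ++ [:: x] = n1 ++ v :: n2 -> v != x ->
  exists n3, s = n1 ++ v :: n3.
Proof.
case/lastP: n2 => [|n2 y] e hv.
  by move: e; rewrite !cats1 => /rcons_inj[_ ex]; rewrite ex eqxx in hv.
move: e; rewrite cats1 -rcons_cons -rcons_cat => /rcons_inj[-> _].
by exists n2.
Qed.

(** The state reached contains [v], so it cannot be a prefix of [m1]; hence it extends [m1] along
    [m], and its first new letter is [v]. *)
Lemma reaches_new m1 m2 v : m = m1 ++ m2 -> v \notin m1 -> v != x ->
  reaches (m1 ++ [:: v]) ->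
  exists n1 n2, m2 = n1 ++ v :: n2 /\ {subset n1 <= m1}.
Proof.
move=> e hv hx [j [nu [hj enu]]].
have vnu : v \in nu by rewrite -(eq_absorb_mem enu) mem_cat mem_seq1 eqxx orbT.
case: hj => [[_ hnu]|[m3 [e3 _]]].
  rewrite hnu e -catA in enu; have [n1 [n2 [en hs]]] := new_letter hv enu.
  by have [n3 ->] := cat_cons_last en hx; exists n1, n3.
have [[u [eu eu']]|[u eu]] :
    (exists u, nu = m1 ++ u /\ m2 = u ++ m3) \/ (exists u, m1 = nu ++ u).
  by apply: cat_eq_cat; rewrite -e -e3.
- rewrite eu in enu; have [n1 [n2 [en hs]]] := new_letter hv enu.
  by exists n1, (n2 ++ m3); rewrite eu' en -catA.
- by rewrite eu mem_cat vnu in hv.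
Qed.

(** The annotation is 1, an absorbed letter, or the next new letter of [m]: rules 17, 18 and 19. *)
Lemma annotation_step t a i mu : (forall v, a = Some v -> v != x) ->
    at_pos t (enc_annotation a) -> state_at i mu -> reaches (mu ++ mon_of_annotation a) ->
  exists l nu, [/\ state_at l nu, eq_absorb (mu ++ mon_of_annotation a) nu
    & fact Annot [:: t; i; l; t]].
Proof.
case: a => [v|] ha hat hi hr; last first.
  exists i, mu; rewrite cats0; split=> //; have [h _] := hat.
  have := @fact_rule w 17 [:: t; i] isT.
  rewrite /= /atom_args /term_val /=; apply=> //.
  by rewrite (letter_le h) (state_le hi).
have hx := ha v erefl; have [h h1] := hat.
have [hv|hv] := boolP (v \in mu).
  exists i, mu; split=> //; first by apply/eq_absorb_catl => z; rewrite inE => /eqP->.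
  have [p [hp h2 hf]] := fact_before hi hv hx.
  have := @fact_rule w 18 [:: t; p; i] isT.
  rewrite /= /atom_args /term_val /=; apply=> //.
    by rewrite (letter_le h) hp (state_le hi).
  by split=> //; split=> //; apply: fact_same_name h2 h1.
(* In state 0 all of [m] and [x] have been read, so a new letter leads to no state. *)
case: (hi) => [[_ emu]|[m2 [e ei]]].
  case: hr => j [nu [hnu /eq_absorb_mem/(_ v)]].
  rewrite mem_cat inE eqxx orbT => /esym hvn; move: hv.
  rewrite emu mem_cat inE (negbTE hx) orbF.
  case: hnu hvn => [[_ ->]|[m2 [-> _]]]; first by rewrite mem_cat inE (negbTE hx) orbF => ->.
  by rewrite mem_cat => ->.
have [n1 [n2 [en hs]]] := reaches_new e hv hx hr.
have e1 : m = (mu ++ n1) ++ v :: n2 by rewrite -catA -en.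
have [h2 h3] := state_letter e1.
have hl : state_at (mpos (rcons (mu ++ n1) v)) (rcons (mu ++ n1) v).
  by right; exists n2; rewrite cat_rcons.
exists (mpos (rcons (mu ++ n1) v)), (rcons (mu ++ n1) v); split=> //.
  by rewrite -cats1; apply: eq_absorb_cat => //; apply/esym/eq_absorb_catl.
have := @fact_rule w 19 [:: t; mpos (mu ++ n1); i; mpos (rcons (mu ++ n1) v)] isT.
rewrite /= /atom_args /term_val /=; apply=> //.
  by rewrite (letter_le h) (letter_le h2) (state_le hi) (state_le hl).
rewrite ei; split; first by apply: (fact_skip (m3 := v :: n2)); rewrite // e en.
split; first exact: fact_same_name h3 h1.
by split=> //; rewrite -mpos_next; apply: fact_name_end; rewrite ?mpos_next ?(state_le hl).
Qed.

(** Since [x] is fresh, the only state containing it is [m x]: it can be read only once the rest of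
    [m] is absorbed. *)
Lemma root_step i mu : state_at i mu -> reaches (mu ++ [:: x]) ->
  eq_absorb (mu ++ [:: x]) (m ++ [:: x]) /\ fact Named [:: 0; 1; i; 0].
Proof.
case=> [[-> ->] _|[m2 [e ei]] [j [nu [hj enu]]]].
  split; first by apply/eq_absorb_catl => z hz; rewrite mem_cat hz orbT.
  have := @fact_rule w 21 [:: 0] isT.
  by rewrite /= /atom_args /term_val /=; apply.
have xnu : x \in nu by rewrite -(eq_absorb_mem enu) mem_cat mem_seq1 eqxx orbT.
case: hj => [[_ enu']|[m3 [e3 _]]]; last by move: xm; rewrite e3 mem_cat xnu.
rewrite enu' in enu; split=> //.
have xmu : x \notin mu by move: xm; rewrite e mem_cat negb_or => /andP[].
have hs : {subset m2 <= mu}.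
  have [|n1 [n2 [en hs]]] := @new_letter mu (m2 ++ [:: x]) x xmu; first by rewrite catA -e.
  case/lastP: n2 en => [|n2 y].
    by rewrite !cats1 => /rcons_inj[->].
  rewrite cats1 -rcons_cons -rcons_cat => /rcons_inj[em2 _].
  by move: xm; rewrite e em2 !mem_cat inE eqxx !orbT.
have hf : fact Skip [:: mpos mu; mpos (mu ++ m2); mpos mu; mpos mu].
  by apply: (@fact_skip _ _ [::]); rewrite ?cats0.
rewrite -e in hf; have := @fact_rule w 20 [:: 0; mpos m; mpos mu] isT.
rewrite ei /= /atom_args /term_val /=; apply=> //; last by rewrite ssep_letter.
by rewrite (letter_le ssep_letter) (mpos_le e).
Qed.

Lemma annotation_new ax a : List.In (ax, a) T -> forall v, a = Some v -> v != x.
Proof. by move=> hin v ea; apply: (xT (ax := ax)); rewrite -ea. Qed.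

Lemma annotation_le t a : at_pos t (enc_annotation a) -> t <= size w.
Proof. by case: a => [v|] /at_le. Qed.

Lemma concept_le p C : at_pos p (enc_concept C) -> p <= size w.
Proof. by case: C => [|A|R C|C D] h; apply: at_le h. Qed.

Lemma reaches_comp mu u1 u2 nu : eq_absorb (mu ++ u1) nu ->
  reaches (mu ++ u1 ++ u2) -> reaches (nu ++ u2).
Proof. by move=> e; rewrite catA; apply: reaches_eq. Qed.

Lemma reaches_prefix2 mu u1 u2 : reaches (mu ++ u1 ++ u2) -> reaches (mu ++ u1).
Proof. by rewrite catA; apply: reaches_prefix. Qed.

Lemma eq_absorb_comp mu u1 u2 nu nu' : eq_absorb (mu ++ u1) nu ->
  eq_absorb (nu ++ u2) nu' -> eq_absorb (mu ++ u1 ++ u2) nu'.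
Proof. by move=> e e2; rewrite /eq_absorb -e2 catA; apply: eq_absorb_cat. Qed.

(** * Simulation of the derivations by facts *)

Lemma role_step R S u : subrole R S u -> forall c i mu,
    at_pos c (enc_name R) -> state_at i mu -> reaches (mu ++ u) ->
  exists l nu s, [/\ state_at l nu, eq_absorb (mu ++ u) nu, at_pos s (enc_name S)
    & fact Role [:: c; s; i; l]].
Proof.
elim=> {R S u} [R|R S S' a u hin _ IH] c i mu hc hi hr.
  exists i, mu, c; rewrite cats0; split=> //.
  have := @fact_rule w 26 [:: c; i] isT.
  rewrite /= /atom_args /term_val /=; apply=> //; first by rewrite (name_le hc) (state_le hi).
  by split=> //; exact: (fact_same_name hc hc).
have [P /at_pos_cat[/= [h /at_pos_cat[h1 h2]]]] := at_axiom A0 B0 m hin.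
rewrite size_cat addnS -addSn addnA => h3.
have hr1 := reaches_prefix2 hr.
have [l [nu [hl el hA]]] := annotation_step (annotation_new hin) h3 hi hr1.
have [j [nu' [s [hj ej hs hR]]]] := IH c l nu hc hl (reaches_comp el hr).
exists j, nu', (P.+1 + size (enc_name S)); split=> //; first exact: eq_absorb_comp el ej.
have := @fact_rule w 25 [:: P; P.+1 + size (enc_name S);
  P.+1 + size (enc_name S) + size (enc_name S'); i; l; j; c; s] isT.
rewrite /= /atom_args /term_val /=; apply=> //.
  by rewrite (letter_le h) (name_le h2) (annotation_le h3) (state_le hi) (state_le hl)
    (state_le hj) (name_le hc) (name_le hs).
split; first by apply: fact_name_end => //; apply: name_le h2.
split; first by apply: fact_name_end => //; apply: annotation_le h3.
by split=> //; split=> //; split=> //; apply: fact_same_name hs h1.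
Qed.

(** Nodes are confused when they end with the same role; of the annotation of their last edge,
    [absorbed] keeps only that its letters have been read. *)
Definition placed (e : node) (c : nat) : Prop :=
  if e is (R, _) :: _ then at_pos c (enc_name R) else c = 0.

Definition absorbed (e : node) (mu : monomial) : Prop :=
  if e is (_, v) :: _ then {subset v <= mu} else True.

Lemma placed_le e c : placed e c -> c <= size w.
Proof. by case: e => [->|[R v] e /name_le]. Qed.

Lemma absorbed_mono e mu u nu : absorbed e mu -> eq_absorb (mu ++ u) nu -> absorbed e nu.
Proof.
case: e => // -[R v] e /= h /eq_absorb_mem enu y /h hy.
by rewrite -enu mem_cat hy.
Qed.

Lemma fact_conc_name c p s i j A mu nu : c <= size w -> state_at i mu -> state_at j nu ->
  at_pos p (enc_concept (CName A)) -> at_pos s (enc_name A) ->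
  fact Named [:: c; s; i; j] -> fact Conc [:: c; p; i; j].
Proof.
move=> hc hi hj [h hp] hs hf; have := @fact_rule w 28 [:: p; c; s; i; j] isT.
rewrite /= /atom_args /term_val /=; apply=> //.
  by rewrite (letter_le h) hc (name_le hs) (state_le hi) (state_le hj).
by split=> //; split=> //; apply: fact_same_name hs hp.
Qed.

(* A name is recorded where it was derived, the other concepts at each of their
   occurrences. *)
Definition recorded (C : concept) (c i j : nat) : Prop :=
  if C is CName A then exists s, at_pos s (enc_name A) /\ fact Named [:: c; s; i; j]
  else forall p, at_pos p (enc_concept C) -> fact Conc [:: c; p; i; j].

Lemma recorded_conc C c p i j mu nu : c <= size w -> state_at i mu -> state_at j nu ->
  recorded C c i j -> at_pos p (enc_concept C) -> fact Conc [:: c; p; i; j].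
Proof.
move=> hc hi hj; case: C => [|A|R C|C D] /=; [by apply| |by apply|by apply].
by case=> s [hs hf] hp; apply: (fact_conc_name hc hi hj hp hs hf).
Qed.

(** The hypothesis that [mu ++ W] leads to a state passes to the factors of [W] from left to right,
    because states are closed under prefixes; each factor then moves the state. *)
Lemma derived_step e C W : derived e C W -> forall c i mu,
    placed e c -> absorbed e mu -> state_at i mu -> reaches (mu ++ W) ->
  exists j nu, [/\ state_at j nu, eq_absorb (mu ++ W) nu & recorded C c i j].
Proof.
elim=> {e C W}.
- move=> e c i mu hc hab hi hr; exists i, mu; rewrite cats0; split=> // p [h _].
  have := @fact_rule w 27 [:: p; i; c] isT.
  rewrite /= /atom_args /term_val /=; apply=> //.
  by rewrite (letter_le h) (state_le hi) (placed_le hc).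
- move=> c i mu /= -> _ hi hr; have [e hf] := root_step hi hr.
  exists 0, (m ++ [:: x]); split=> //; first by left.
  by exists 1; split=> //; apply: at_lhs.
- move=> e C D u v _ IH1 _ IH2 c i mu hc hab hi hr.
  have hr1 := reaches_prefix2 hr.
  have [l [nu [hl el f1]]] := IH1 c i mu hc hab hi hr1.
  have [j [nu' [hj ej f2]]] :=
    IH2 c l nu hc (absorbed_mono hab el) hl (reaches_comp el hr).
  exists j, nu'; split=> //; first exact: eq_absorb_comp el ej.
  move=> p [h /at_pos_cat[h1 h2]].
  have hle : p.+1 + size (enc_concept C) <= size w by exact: concept_le h2.
  have := @fact_rule w 29 [:: p; p.+1 + size (enc_concept C); c; i; l; j] isT.
  rewrite /= /atom_args /term_val /=; apply=> //.
    by rewrite (letter_le h) hle (placed_le hc) (state_le hi) (state_le hl) (state_le hj).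
  split; first exact: fact_concept_end.
  have hcw := placed_le hc; split; first exact: (recorded_conc hcw hi hl f1 h1).
  by split=> //; apply: (recorded_conc hcw hl hj f2 h2).
- move=> e C A a u hin _ IH c i mu hc hab hi hr.
  have [P /at_pos_cat[/= [h /at_pos_cat[h1 [h2 h2']]]]] := at_axiom A0 B0 m hin.
  rewrite size_cat addnS -addSn addnA /= addnS -addSn => h3.
  have hr1 := reaches_prefix2 hr.
  have [l [nu [hl el hA]]] := annotation_step (annotation_new hin) h3 hi hr1.
  have [j [nu' [hj ej f2]]] :=
    IH c l nu hc (absorbed_mono hab el) hl (reaches_comp el hr).
  exists j, nu'; split=> //; first exact: eq_absorb_comp el ej.
  eexists; split; first exact: h2'.
  set t := (_ + size (enc_name A)) in h3 hA.
  have := @fact_rule w 22 [:: P; P.+1 + size (enc_concept C); t; i; l; j; c] isT.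
  rewrite /= /atom_args /term_val /=; apply=> //.
    by rewrite (letter_le h) (letter_le h2) (annotation_le h3) (state_le hi) (state_le hl)
      (state_le hj) (placed_le hc).
  split; first by apply: fact_concept_end => //; apply: letter_le h2.
  split; first by apply: fact_name_end => //; apply: annotation_le h3.
  by split=> //; split=> //; apply: (recorded_conc (placed_le hc) hl hj f2 h1).
- move=> e C R a u S v D u' hin _ IH hs _ IH' c i mu hc hab hi hr.
  have [P /at_pos_cat[/= [h3 /at_pos_cat[h4 [h5 h6]]]]] := at_axiom A0 B0 m hin.
  rewrite size_cat addnS -addSn addnA /= addnS -addSn => h7.
  set r := (_ + size (enc_concept C)) in h5 h6 h7.
  set t := (_ + size (enc_name R)) in h7.
  have hr1 := reaches_prefix2 hr.
  have [l [nu [s [hl el hS fR]]]] := role_step hs h6 hi hr1.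
  have {}hr := reaches_comp el hr.
  have hr2 : reaches (nu ++ mon_of_annotation a).
    by apply: (@reaches_prefix _ (u ++ u')); rewrite !catA in hr *.
  have [l1 [nu1 [hl1 el1 fA]]] := annotation_step (annotation_new hin) h7 hl hr2.
  have hr3 : reaches (nu1 ++ u ++ u') by apply: reaches_comp el1 _; rewrite !catA in hr *.
  have hr4 := reaches_prefix2 hr3.
  have [k [nu2 [hk ek fC]]] :=
    IH c l1 nu1 hc (absorbed_mono (absorbed_mono hab el) el1) hl1 hr4.
  have e2 : eq_absorb (nu ++ (mon_of_annotation a ++ u)) nu2 := eq_absorb_comp el1 ek.
  (* The successor is placed at the role on the right-hand side of the axiom, and its edge
     annotation has just been read. *)
  have [|j [nu3 [hj ej fD]]] := IH' r.+1 k nu2 h6 _ hk (reaches_comp e2 hr).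
    by move=> y hy; rewrite -(eq_absorb_mem e2) mem_cat hy orbT.
  exists j, nu3; split=> //; first exact: eq_absorb_comp el (eq_absorb_comp e2 ej).
  have fS : fact Succ [:: c; r.+1; l; k].
    have := @fact_rule w 23 [:: P; r; t; l; l1; k; c] isT.
    rewrite /= /atom_args /term_val /=; apply=> //.
      by rewrite (letter_le h3) (letter_le h5) (annotation_le h7) (state_le hl) (state_le hl1)
        (state_le hk) (placed_le hc).
    split; first by apply: fact_concept_end => //; apply: letter_le h5.
    split; first by apply: fact_name_end => //; apply: annotation_le h7.
    by split=> //; split=> //; apply: (recorded_conc (placed_le hc) hl1 hk fC h4).
  move=> p [h /at_pos_cat[h1 h2]].
  have hle : p.+1 + size (enc_name S) <= size w by exact: concept_le h2.
  have := @fact_rule w 30 [:: p; p.+1 + size (enc_name S); r.+1; s; c; i; l; k; j] isT.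
  rewrite /= /atom_args /term_val /=; apply=> //.
    by rewrite (letter_le h) hle (name_le h6) (name_le hS) (placed_le hc) (state_le hi)
      (state_le hl) (state_le hk) (state_le hj).
  split; first exact: fact_name_end.
  split=> //; split; first exact: fact_same_name hS h1.
  by split=> //; split=> //; apply: (recorded_conc (name_le h6) hk hj fD h2).
- move=> e R v S u A a hin hs c i mu hc hab hi hr.
  have [P /at_pos_cat[/= [h /at_pos_cat[h1 h2]]]] := at_axiom A0 B0 m hin.
  rewrite size_cat addnS -addSn addnA => h3.
  have hr1 := reaches_prefix2 hr.
  have [l [nu [hl el hA]]] := annotation_step (annotation_new hin) h3 hi hr1.
  have {}hr := reaches_comp el hr.
  have hr2 := reaches_prefix2 hr.
  have [j [nu' [s [hj ej hS hR]]]] := role_step hs hc hl hr2.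
  exists j, nu'; split=> //.
    (* The trailing edge annotation [v] changes nothing, being absorbed from the start. *)
    apply: (eq_absorb_comp el); rewrite catA /eq_absorb -ej; apply/eq_absorb_catl => y /hab hy.
    by rewrite mem_cat -(eq_absorb_mem el) mem_cat hy.
  eexists; split; first exact: h2.
  set t := (_ + size (enc_name A)) in h3 hA.
  have := @fact_rule w 24 [:: P; P.+1 + size (enc_name S); t; i; l; j; c; s] isT.
  rewrite /= /atom_args /term_val /=; apply=> //.
    by rewrite (letter_le h) (name_le h2) (annotation_le h3) (state_le hi) (state_le hl)
      (state_le hj) (name_le hc) (name_le hS).
  split; first by apply: fact_name_end => //; apply: name_le h2.
  split; first by apply: fact_name_end => //; apply: annotation_le h3.
  by split=> //; split=> //; split=> //; apply: fact_same_name hS h1.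
Qed.

Lemma derived_fact W : derived [::] (CName B0) W -> eq_absorb W (m ++ [:: x]) ->
  fact Goal [:: 0; 0; 0; 0].
Proof.
move=> hd hW; have h0 : state_at (mpos [::]) [::] by right; exists m.
have [|j [nu [hj ej [s [hs hf]]]]] := derived_step hd (erefl : placed [::] 0) I h0.
  by exists 0, (m ++ [:: x]); split=> //; left.
(* The final prefix contains [x], which no prefix of [m] does. *)
have j0 : j = 0.
  case: hj => [[]//|[m2 [em _]]]; move: xm; rewrite em mem_cat.
  by rewrite -(eq_absorb_mem ej) /= (eq_absorb_mem hW) mem_cat mem_seq1 eqxx orbT.
rewrite {}j0 in hf; have h2 := at_rhs T A0 B0 m.
have hm : mpos [::] = 1 + size (enc_name A0) + size (enc_name B0) by rewrite /mpos /=; lia.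
have := @fact_rule w 31 [:: 0; 1 + size (enc_name A0); mpos [::]; s] isT.
rewrite /= /atom_args /term_val /=; apply=> //.
  by rewrite (name_le h2) (state_le h0) (name_le hs).
split; first by apply: fact_name_end; [apply: at_lhs|apply: name_le h2].
split; first by rewrite hm; apply: fact_name_end; rewrite -?hm ?(state_le h0).
by split=> //; split=> //; apply: fact_same_name hs h2.
Qed.

End Completeness.

Lemma fresh_var (l : seq pvar) : exists x, x \notin l.
Proof.
pose N := \max_(v <- l) size v; exists (nseq N.+1 true).
have hN y : y \in l -> size y <= N by move=> hy; rewrite /N (big_rem _ hy) /= leq_maxl.
by apply/negP => /hN; rewrite size_nseq ltnn.
Qed.

Lemma entails_fact T A0 B0 m : entails T (GCI (CName A0) (RName B0)) m ->
  fact (enc_instance (Instance T A0 B0 m)) Goal (nseq 4 0).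
Proof.
have [x] := fresh_var (m ++ pmap snd T).
rewrite mem_cat negb_or => /andP[xm xT] /(entails_derived x)[W hd hW].
apply: derived_fact xm _ _ hd hW => ax v hin; apply: contraNneq xT => <-.
elim: (T) hin => //= -[ax' [v'|]] T' IH [[_ ?]|/IH h] //=.
  by subst; rewrite inE eqxx.
by rewrite inE h orbT.
Qed.

Theorem theorem5 :
  decidable_in_ptime enc_instance
    (fun x : instance =>
       entails (inst_tbox x)
         (GCI (CName (inst_lhs x)) (RName (inst_rhs x)))
         (inst_mon x)).
Proof.
(* Rule 30 has the nine variables 0 to 8, and every predicate has four arguments. *)
apply: (@datalog_ptime _ _ 9 4 derivation_rules Goal _ _ _ _ derivation_rules_wf) => //.
move=> [T A0 B0 m].
by split=> [/fact_entails|/entails_fact].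
Qed.
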